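(* Let $K$ be a field of characteristic zero, and consider $\overline{M}_{0,7}$ over $K$ in its Kapranov model with respect to the seventh marked point. A class $D\in\operatorname{Pic}(\overline{M}_{0,7})$ is both irreducible in the monoid $M(\overline{M}_{0,7})$ of effective divisor classes and of the form $D=D_\Delta$ for some nonempty nonsingular complex $\Delta$ on $\{1,2,\ldots,6\}$ that is balanceable over $K$ if and only if $D=D_\Gamma$ for one of the following complexes $\Gamma$, where in each case the subindices are distinct elements of $\{1,\ldots,6\}$: $$\begin{aligned} B_{ij}&=\{\{i\},\{j\}\},\\ H_{ijkpqr}&=\{\{i,j\},\{j,k\},\{k,p\},\{p,q\},\{q,r\},\{r,i\}\},\\ T_{(i)(jk)(pq)}&=\{\{i,j\},\{i,k\},\{j,k\},\{i,p\},\{i,q\},\{p,q\}\},\\ P_{(i)(jk)(r)(pq)}&=\{\{i,j\},\{i,k\},\{j,k\},\{r,p\},\{r,q\},\{p,q\},\{i,r\}\},\\ \mathcal{C}_{(i_1i_4)(i_2i_3)(i_5i_6)}&=\{\{i_1,i_2,i_3\},\{i_1,i_2,i_4\},\{i_1,i_3,i_4\},\{i_1,i_4,i_5\},\{i_1,i_4,i_6\},\{i_1,i_5,i_6\},\\ &\qquad \{i_2,i_3,i_4\},\{i_2,i_3,i_5\},\{i_2,i_3,i_6\},\{i_2,i_5,i_6\},\{i_3,i_5,i_6\},\{i_4,i_5,i_6\}\}. \end{aligned}$$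
   Context: Complexes: for an integer $d\ge0$, a $d$-simplex on a set $\mathcal{S}$ is a multiset of cardinality $d+1$ with elements in $\mathcal{S}$; a $d$-complex on $\mathcal{S}$ is a (finite) set of $d$-simplices on $\mathcal{S}$; a complex is a $d$-complex for some $d\ge 0$. A complex is nonsingular if in each of its simplices every element has multiplicity one. $m(i\in S)$ is the multiplicity of $i$ in the multiset $S$, and $m(T\subseteq S)=\prod_{i}\binom{m(i\in S)}{m(i\in T)}$ (zero if $T\not\subseteq S$). A $d$-complex $\Delta$ is balanceable over $K$ if there is a function $w:\Delta\to K$ with $w(\sigma)\neq0$ for all $\sigma\in\Delta$ and such that $\sum_{S\subseteq\sigma\in\Delta}w(\sigma)\,m(S\subseteq\sigma)=0$ for every multiset $S$ on $\mathcal{S}$ with $0\le|S|\le d$. Kapranov model: $\overline{M}_{0,7}$ is identified with the iterated blow up of $\mathbb{P}^{4}$ along all linear subspaces spanned by subsets $\{p_i\}_{i\in I}$, $1\le|I|\le3$, of six fixed points $p_1,\ldots,p_6$ in linearly general position (points first, then strict transforms of lines, then strict transforms of planes). $H$ is the pullback of the hyperplane class and $E_I$ is the (strict transform of the) exceptional divisor over the span of $\{p_i\}_{i\in I}$; $H$ and the $E_I$ with $1\le|I|\le 3$ form a $\mathbb{Z}$-basis of $\operatorname{Pic}(\overline{M}_{0,7})$. For a nonempty $d$-complex $\Delta$ on $\{1,\ldots,6\}$, $$D_\Delta=(d+1)H-\sum_{I}\Big(d+1-\max_{\sigma\in\Delta}\sum_{i\in I}m(i\in\sigma)\Big)E_I,$$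 the sum being over $I\subseteq\{1,\ldots,6\}$ with $1\le|I|\le3$. $M(\overline{M}_{0,7})$ is the monoid of classes in $\operatorname{Pic}(\overline{M}_{0,7})$ having an effective divisor representative; a nonzero element is irreducible if it is not a sum of two elements of the monoid unless one of them is zero. *)

(* Defs.v *)
From HB Require Import structures.
From mathcomp Require Import all_boot all_order all_algebra.
From mathcomp Require Import finmap multiset mpoly.

Set Implicit Arguments.
Unset Strict Implicit.
Unset Printing Implicit Defensive.

Import Order.TTheory GRing.Theory Num.Theory.

Local Open Scope fset_scope.
Local Open Scope mset_scope.
Local Open Scope ring_scope.

(** * Complexes *)

Section Complexes.
Variable T : finType.
Implicit Types (Delta : {fset {mset T}}) (S sigma : {mset T}).

Definition is_complex (d : nat) Delta : Prop :=
  forall sigma, sigma \in Delta -> size sigma = d.+1.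

Definition nonsingular Delta : Prop :=
  forall sigma, sigma \in Delta -> forall i, i \in sigma -> sigma i = 1%N.

(* The factors with i outside S are 'C(_, 0) = 1. *)
Definition submult S sigma : nat := (\prod_(i : T) 'C(sigma i, S i))%N.

(* Only the values of w on Delta matter. *)
Definition balanceable (K : fieldType) (d : nat) Delta : Prop :=
  exists w : {mset T} -> K,
    (forall sigma, sigma \in Delta -> w sigma != 0) /\
    (forall S, (size S <= d)%N ->
       \sum_(sigma <- Delta | (S `<=` sigma)%mset)
          w sigma * (submult S sigma)%:R = 0).

End Complexes.

(** * The Picard group of the blow up of P^4 *)

(* The index sets of the blown up points, lines and planes. The mark i of
   {1, ..., 6} is the ordinal i - 1. *)
Definition center : finType := {I : {set 'I_6} | (1 <= #|I| <= 3)%N}.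

(* Pic, in coordinates with respect to the basis H, E_I. *)
Definition Pic : zmodType := (int * {ffun center -> int})%type.

Definition Hcl : Pic := (1, 0).
Definition Ecl (I : center) : Pic := (0, [ffun J => (J == I)%:Z]).

Definition complex_class (d : nat) (Delta : {fset {mset 'I_6}}) : Pic :=
  Hcl *~ d.+1%:Z -
  \sum_(I : center)
    Ecl I *~ (d.+1%:Z -
            (\max_(sigma <- Delta) \sum_(i in val I) sigma i)%N%:Z).

(** * Effective divisors *)

Section Effective.
Variable K : fieldType.

(* The rows of p are homogeneous coordinates of six points of P^4; any five
   of them are linearly independent. *)
Definition general_position (p : 'M[K]_(6, 5)) : Prop :=
  forall i : 'I_6, row_free (row' i p).

Definition in_span (p : 'M[K]_(6, 5)) (I : {set 'I_6}) (v : 'rV[K]_5) : Prop :=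
  (v <= \sum_(i in I) <<row i p>>)%MS.

Definition translate (v : 'rV[K]_5) (F : {mpoly K[5]}) : {mpoly K[5]} :=
  F \mPo [tuple 'X_i + (v 0 i)%:MP | i < 5].

(* For F homogeneous and v != 0, the hypersurface F = 0 has multiplicity at
   least m at the point [v]: its affine cone is, at v, locally the product of
   the hypersurface and a line. *)
Definition mult_ge_at (F : {mpoly K[5]}) (v : 'rV[K]_5) (m : nat) : Prop :=
  forall u : 'X_{1..5}, (mdeg u < m)%N -> (translate v F)@_u = 0.

Definition mult_ge_along (p : 'M[K]_(6, 5)) (I : {set 'I_6})
    (F : {mpoly K[5]}) (m : nat) : Prop :=
  forall v : 'rV[K]_5, v != 0 -> in_span p I v -> mult_ge_at F v m.

(* The multiplicity along a linear subspace, i.e. at its generic point, is the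
   least multiplicity at one of its points; the rational points suffice as K
   will be infinite. *)
Definition mult_along (p : 'M[K]_(6, 5)) (I : {set 'I_6})
    (F : {mpoly K[5]}) (m : nat) : Prop :=
  mult_ge_along p I F m /\ ~ mult_ge_along p I F m.+1.

(* An effective divisor of the blow up is the strict transform of an effective
   divisor F = 0 of P^4, F a nonzero form, plus a nonnegative combination of
   exceptional divisors. The pullback of F = 0 contains E_I with coefficient
   the multiplicity of F along the span of I, so the strict transform has
   class deg(F) H - \sum_I mult_I(F) E_I. *)
Definition effective (p : 'M[K]_(6, 5)) (D : Pic) : Prop :=
  exists (deg : nat) (F : {mpoly K[5]}) (mu a : center -> nat),
    [/\ F != 0, F \is deg.-homog,
        forall I : center, mult_along p (val I) F (mu I) &
        D = (Hcl *~ deg%:Z - \sum_(I : center) Ecl I *~ (mu I)%:Z)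
            + \sum_(I : center) Ecl I *~ (a I)%:Z].

Definition irreducible_class (p : 'M[K]_(6, 5)) (D : Pic) : Prop :=
  [/\ effective p D, D != 0 &
      forall A B : Pic, effective p A -> effective p B -> D = A + B ->
        A = 0 \/ B = 0].

End Effective.

(** * The complexes of the classification *)

Section Families.
Local Open Scope fset_scope.
Local Open Scope mset_scope.
Implicit Types i j k p q r : 'I_6.

Definition complexB i j : {fset {mset 'I_6}} := [fset [mset i]; [mset j]].

Definition complexH i j k p q r : {fset {mset 'I_6}} :=
  [fset [mset i; j]; [mset j; k]; [mset k; p];
        [mset p; q]; [mset q; r]; [mset r; i]].

Definition complexT i j k p q : {fset {mset 'I_6}} :=
  [fset [mset i; j]; [mset i; k]; [mset j; k];
        [mset i; p]; [mset i; q]; [mset p; q]].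

Definition complexP i j k r p q : {fset {mset 'I_6}} :=
  [fset [mset i; j]; [mset i; k]; [mset j; k];
        [mset r; p]; [mset r; q]; [mset p; q]; [mset i; r]].

(* The six marks are taken in the order i_1, ..., i_6. *)
Definition complexC (i1 i2 i3 i4 i5 i6 : 'I_6) : {fset {mset 'I_6}} :=
  [fset [mset i1; i2; i3]; [mset i1; i2; i4]; [mset i1; i3; i4];
        [mset i1; i4; i5]; [mset i1; i4; i6]; [mset i1; i5; i6];
        [mset i2; i3; i4]; [mset i2; i3; i5]; [mset i2; i3; i6];
        [mset i2; i5; i6]; [mset i3; i5; i6]; [mset i4; i5; i6]].

End Families.

(* Main.v *)
Require Import Defs.
From HB Require Import structures.
From mathcomp Require Import all_boot all_order all_algebra.
From mathcomp Require Import finmap multiset mpoly.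
From mathcomp Require Import zify ring.

Set Implicit Arguments.
Unset Strict Implicit.
Unset Printing Implicit Defensive.

Import Order.TTheory GRing.Theory Num.Theory.

Local Open Scope fset_scope.
Local Open Scope mset_scope.
Local Open Scope ring_scope.

(** Six points of P^4 in linearly general position satisfy one linear relation,
    with nonzero coefficients. After rescaling, the points are the images of the
    unit vectors under a surjection K^6 -> K^5 whose kernel is spanned by
    (1, ..., 1). Pulling back along it identifies the forms on P^4 with the forms
    f(x_1, ..., x_6) invariant under the translations x_i -> x_i + l. The
    multiplicity along the span of the points in I becomes the least degree of a
    monomial of f in the variables outside I. Hence the effective classes are
    described by supports of invariant forms: [effectiveP]. The proof that a
    multiplicity bounds the monomials evaluates at points, which suffices as K
    is infinite ([ord_ge_points]).

    Expanding f(x + l) in powers of l shows that invariance is exactly the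
    balancing condition on the coefficients ([translation_invariantP],
    [balanceableP]). So D_Delta, for Delta balanceable, is the class of an
    invariant form with support Delta.

    Products of forms add classes, and passing to a smaller support subtracts
    exceptional divisors. Conversely, when Delta is squarefree of degree at most
    three, every decomposition of its class arises in this way, because a monomial
    then involves at most three points and is seen by the multiplicities along
    points, lines and planes ([sum_support]). It follows
    that D_Delta is irreducible exactly when the support of every nonzero
    invariant form supported in Delta is the whole of Delta, and Delta contains
    no product of two forms of positive degree ([class_split],
    [irreducible_circuit]).

    It remains to find these minimal supports. A squarefree invariant form of
    degree four or more vanishes ([squarefree_degree]). In degree one the
    supports are pairs. In degree two they are graphs with nonzero edge weights
    summing to zero at each vertex; such a graph contains a square, two triangles
    sharing a vertex, a hexagon, or two triangles joined by an edge
    ([balanced_graph]), and only the square factors. In degree three the link of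
    a vertex is such a graph on five vertices. It contains a square or two
    triangles sharing a vertex, and since complementary triples have opposite
    weights ([coef_setC]), the complex contains an octahedron, which is a product
    of three differences, or the complex with twelve faces
    ([forward_triples]). *)

(** * Order of a polynomial along a coordinate subspace *)

Section Order.
Variable K : fieldType.
Variable n : nat.
Implicit Types (I : {set 'I_n}) (u v : 'X_{1..n}) (f g : {mpoly K[n]}).

Definition outdeg I u := (\sum_(i in ~: I) u i)%N.

(** The form vanishes to order at least m along the subspace where the
    coordinates outside I are zero; for I empty, at the origin. *)
Definition ord_ge I m f := forall u, u \in msupp f -> (m <= outdeg I u)%N.

Lemma outdeg_set0 u : outdeg set0 u = mdeg u.
Proof. by rewrite mdegE; apply: eq_bigl => i; rewrite !inE. Qed.

Lemma outdegD I u v : outdeg I (u + v) = (outdeg I u + outdeg I v)%N.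
Proof. by rewrite -big_split; apply: eq_bigr => i _; rewrite mnmDE. Qed.

Lemma ord_ge_sum I m (T : Type) (r : seq T) (P : pred T)
    (F : T -> {mpoly K[n]}) :
  (forall x, P x -> ord_ge I m (F x)) -> ord_ge I m (\sum_(x <- r | P x) F x).
Proof.
move=> ordF; apply: (big_ind (ord_ge I m)) => //.
- by move=> u; rewrite msupp0.
- move=> f g of_ og u /msuppD_le; rewrite mem_cat => /orP[]; [exact: of_|exact: og].
Qed.

Lemma ord_geZ I m c f : ord_ge I m f -> ord_ge I m (c *: f).
Proof. by move=> of_ u /msuppZ_le; apply: of_. Qed.

Lemma ord_geM I a b f g :
  ord_ge I a f -> ord_ge I b g -> ord_ge I (a + b) (f * g).
Proof.
move=> of_ og u /msuppM_le /allpairsP[[u1 u2] [/= u1f u2g ->]].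
by rewrite outdegD leq_add ?of_ ?og.
Qed.

Lemma ord_ge_prod I (T : finType) (a : T -> nat) (F : T -> {mpoly K[n]}) :
  (forall x, ord_ge I (a x) (F x)) ->
  ord_ge I (\sum_x a x)%N (\prod_x F x).
Proof.
move=> ordF; apply: (big_ind2 (ord_ge I)) => //.
by move=> b g c h; apply: ord_geM.
Qed.

Lemma ord_geX I a f b : ord_ge I a f -> ord_ge I (b * a) (f ^+ b).
Proof.
move=> of_; elim: b => [|b IHb]; first by rewrite mul0n.
by rewrite mulSn exprS; apply: ord_geM.
Qed.

(** A substitution that sends the variables outside J to forms vanishing along
    the subspace of I does not lower the order. *)
Lemma ord_ge_comp I N (J : {set 'I_N}) m (f : {mpoly K[N]})
    (t : N.-tuple {mpoly K[n]}) :
  (forall i, i \notin J -> ord_ge I 1 (tnth t i)) ->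
  (forall u : 'X_{1..N}, u \in msupp f -> (m <= \sum_(i in ~: J) u i)%N) ->
  ord_ge I m (f \mPo t).
Proof.
move=> ord_t ord_f; rewrite comp_mpolyEX.
rewrite big_seq; apply: ord_ge_sum => u uf; apply: ord_geZ.
rewrite comp_mpolyX => v vin; apply: leq_trans (ord_f _ uf) _.
rewrite big_mkcond /=.
apply: (ord_ge_prod (a := fun i => if i \in ~: J then u i else 0)) vin => i.
case: ifP => //; rewrite inE => iJ.
by rewrite -[X in ord_ge _ X]muln1; apply: ord_geX; apply: ord_t.
Qed.

End Order.

(** * Linear changes of variables *)

Section Linear.
Variable K : fieldType.

(** Substituting these forms composes a polynomial with x |-> x M. *)
Definition linear_forms m n (M : 'M[K]_(m, n)) : n.-tuple {mpoly K[m]} :=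
  [tuple \sum_(i < m) M i j *: 'X_i | j < n].

Definition shift n (ell : 'I_n -> {mpoly K[n]}) : n.-tuple {mpoly K[n]} :=
  [tuple 'X_i + ell i | i < n].

Lemma comp_mpolyA k m n (p : {mpoly K[k]}) (q : k.-tuple {mpoly K[m]})
    (r : m.-tuple {mpoly K[n]}) :
  (p \mPo q) \mPo r = p \mPo [tuple tnth q i \mPo r | i < k].
Proof.
rewrite (comp_mpolyEX p) raddf_sum (comp_mpolyEX p); apply: eq_bigr => u _ /=.
rewrite comp_mpolyZ !comp_mpolyX rmorph_prod; congr (_ *: _).
by apply: eq_bigr => i _; rewrite rmorphXn tnth_mktuple.
Qed.

Lemma comp_mpolyXi k n (q : k.-tuple {mpoly K[n]}) i : 'X_i \mPo q = tnth q i.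
Proof. by rewrite comp_mpolyXU (tnth_nth 0). Qed.

Lemma linear_formsM k m n (M : 'M[K]_(k, m)) (N : 'M[K]_(m, n)) :
  [tuple tnth (linear_forms N) j \mPo linear_forms M | j < n]
  = linear_forms (M *m N).
Proof.
apply: eq_mktuple => j; rewrite tnth_mktuple raddf_sum /=.
under eq_bigr => i _ do
  rewrite comp_mpolyZ comp_mpolyXi tnth_mktuple scaler_sumr.
rewrite exchange_big; apply: eq_bigr => i _ /=.
rewrite mxE scaler_suml; apply: eq_bigr => l _.
by rewrite scalerA mulrC.
Qed.

Lemma linear_forms1 n : linear_forms (1%:M) = [tuple 'X_i | i < n].
Proof.
apply: eq_mktuple => j; rewrite (bigD1 j) //= mxE eqxx scale1r.
by rewrite big1 ?addr0 // => i /negPf ij; rewrite mxE ij scale0r.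
Qed.

Lemma ord_ge_linear_forms m n (M : 'M[K]_(m, n)) j :
  ord_ge set0 1 (tnth (linear_forms M) j).
Proof.
rewrite tnth_mktuple; apply: ord_ge_sum => i _; apply: ord_geZ => u.
by rewrite msuppX inE => /eqP ->; rewrite outdeg_set0 mdeg1.
Qed.

Lemma dhomog_linear_forms m n (M : 'M[K]_(m, n)) d (F : {mpoly K[n]}) :
  F \is d.-homog -> F \mPo linear_forms M \is d.-homog.
Proof.
move=> /dhomogP homF; rewrite comp_mpolyEX big_seq rpred_sum // => u uF.
have <- : mdeg u = d := homF _ uF.
rewrite rpredZ // mdegE comp_mpolyX.
apply: (big_ind2 (fun (p : {mpoly K[m]}) e => p \is e.-homog)) => //.
- exact: dhomog1.
- by move=> p a q b; apply: dhomogM.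
move=> i _; elim: (u i) => [|e IHe]; first exact: dhomog1.
rewrite exprS -add1n; apply: dhomogM => //.
rewrite tnth_mktuple rpred_sum // => l _; rewrite rpredZ //.
by rewrite dhomogX /= mdeg1.
Qed.

(** Translating by x before a linear map is translating by its image after it. *)
Lemma translate_linear_forms N n (Q : 'M[K]_(N, n)) (x : 'rV[K]_N)
    (F : {mpoly K[n]}) :
  (F \mPo [tuple 'X_i + ((x *m Q) 0 i)%:MP | i < n]) \mPo linear_forms Q =
  (F \mPo linear_forms Q) \mPo shift (fun i => (x 0 i)%:MP).
Proof.
rewrite !comp_mpolyA; congr (F \mPo _); apply: eq_mktuple => j.
rewrite !tnth_mktuple comp_mpolyD comp_mpolyC comp_mpolyXi tnth_mktuple.
rewrite [RHS]raddf_sum /= mxE rmorph_sum /= -big_split /=.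
apply: eq_bigr => i _; rewrite comp_mpolyZ comp_mpolyXi tnth_mktuple.
by rewrite scalerDr -[_ *: _%:MP]mul_mpolyC -mpolyCM mulrC.
Qed.

End Linear.

(** * Order along a subspace, point by point *)

Section Points.
Variable K : fieldType.
Hypothesis charK : [pchar K] =i pred0.

Lemma natr_eq0 k : (k%:R == 0 :> K) = (k == 0%N).
Proof. by move/pcharf0P: charK => ->. Qed.

Lemma natr_inj : injective (fun k : nat => k%:R : K).
Proof.
move=> a b; wlog le_ab : a b / (a <= b)%N => [hw eq_ab|/eqP].
  by case/orP: (leq_total a b) => le; [apply: hw|apply/esym/hw].
rewrite eq_sym -subr_eq0 -natrB // natr_eq0 subn_eq0 => le_ba.
by apply/eqP; rewrite eqn_leq le_ab.
Qed.

Lemma poly_nonvanishing (p : {poly K}) : p != 0 -> exists k, p.[k.+1%:R] != 0.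
Proof.
move=> nz_p; pose rs : seq K := [seq k.+1%:R | k <- iota 0 (size p)].
have [/allP roots|/allPn[_ /mapP[k _ ->]]] := boolP (all (root p) rs); last first.
  by exists k.
suff /(max_poly_roots nz_p (introT allP roots)) : uniq rs.
  by rewrite size_map size_iota ltnn.
rewrite map_inj_uniq ?iota_uniq // => a b eq_ab.
by have /succn_inj := natr_inj eq_ab.
Qed.

Lemma digits_inj n N (u v : 'I_n -> nat) :
  (forall i, u i < N)%N -> (forall i, v i < N)%N ->
  (\sum_i u i * N ^ i = \sum_i v i * N ^ i)%N -> u =1 v.
Proof.
elim: n u v => [|n IHn] u v ltu ltv; first by move=> _ [].
have N0 : (0 < N)%N by apply: leq_trans (ltu ord0).
have split w : (\sum_(i < n.+1) w i * N ^ i =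
    (\sum_(i < n) w (lift ord0 i) * N ^ i) * N + w ord0)%N.
  rewrite big_ord_recl muln1 addnC big_distrl; congr (_ + _)%N.
  by apply: eq_bigr => i _; rewrite expnSr mulnA.
rewrite !split => eq_uv.
have eq0 : u ord0 = v ord0.
  by have := congr1 (modn^~ N) eq_uv; rewrite !modnMDl !modn_small.
have /IHn eqS : (\sum_(i < n) u (lift ord0 i) * N ^ i =
    \sum_(i < n) v (lift ord0 i) * N ^ i)%N.
  by move: eq_uv; rewrite eq0 => /addIn /eqP; rewrite eqn_pmul2r // => /eqP.
by move=> i; case: (unliftP ord0 i) => [j|] ->; rewrite ?eq0 ?eqS.
Qed.

(** Kronecker substitution: for N larger than all exponents, the monomials of
    [f] become distinct powers of t under x_i = t^(N^i), so [f] restricts to a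
    nonzero polynomial in t. *)
Lemma mpoly_nonvanishing n (f : {mpoly K[n]}) : f != 0 ->
  exists2 x : 'I_n -> K, (forall i, x i != 0) & f.@[x] != 0.
Proof.
move=> nz_f; pose N := msize f.
pose code (u : 'X_{1..n}) := (\sum_i u i * N ^ i)%N.
have ltN u : u \in msupp f -> forall i, (u i < N)%N.
  move=> /msize_mdeg_lt ltN i; apply: leq_ltn_trans ltN.
  by rewrite mdegE (bigD1 i) //= leq_addr.
pose q := \sum_(u <- msupp f) f@_u *: 'X^(code u) : {poly K}.
have qE t : q.[t] = f.@[fun i => t ^+ (N ^ i)].
  rewrite mevalE horner_sum; apply: eq_bigr => u _.
  rewrite hornerZ hornerXn; congr (_ * _); rewrite expr_sum.
  by apply: eq_bigr => i _; rewrite mulnC exprM.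
have nz_q : q != 0.
  have uf : mlead f \in msupp f by apply: mlead_supp.
  apply/eqP => /(congr1 (fun p : {poly K} => p`_(code (mlead f)))).
  rewrite coef0 coef_sum (bigD1_seq (mlead f)) //= coefZ coefXn eqxx mulr1.
  rewrite big_seq_cond big1 ?addr0 => [/eqP|u /andP[uf' nu]].
    by rewrite mcoeff_eq0 uf.
  rewrite coefZ coefXn; case: eqP => [eq_code|]; last by rewrite mulr0.
  case/negP: nu; apply/eqP/mnmP => i.
  by apply/esym/(digits_inj (ltN _ uf) (ltN _ uf')).
have [k nz_qk] := poly_nonvanishing nz_q.
exists (fun i => k.+1%:R ^+ (N ^ i)); last by rewrite -qE.
by move=> i; rewrite expf_neq0 // natr_eq0.
Qed.

(** For x on the subspace and y outside it, the coefficient of t^k in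
    f(x + t y) is the part of [f] of degree k in the outer variables, evaluated
    at (x, y); all of them vanish for k < m, and a polynomial vanishing at all
    points with nonzero coordinates is zero. *)
Lemma ord_ge_points n (I : {set 'I_n}) m (f : {mpoly K[n]}) i0 : i0 \in I ->
  (forall x : 'rV[K]_n, x != 0 -> (forall i, i \notin I -> x 0 i = 0) ->
     ord_ge set0 m (f \mPo shift (fun i => (x 0 i)%:MP))) ->
  ord_ge I m f.
Proof.
move=> Ii0 ord_f u0 u0f; rewrite leqNgt; apply/negP; set k := outdeg I u0 => ltkm.
pose fk := \sum_(u <- msupp f | outdeg I u == k) f@_u *: 'X_[u] : {mpoly K[n]}.
have nz_fk : fk != 0.
  apply/eqP => /(congr1 (mcoeff u0)); rewrite mcoeff0 raddf_sum /=.
  rewrite big_mkcond (bigD1_seq u0) //= eqxx mcoeffZ mcoeffX eqxx mulr1 big1.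
    by move/eqP; rewrite addr0 mcoeff_eq0 u0f.
  by move=> u /negPf nu; case: ifP => //; rewrite mcoeffZ mcoeffX nu mulr0.
have [z nz_z nz_fkz] := mpoly_nonvanishing nz_fk.
pose x := \row_i (if i \in I then z i else 0).
pose y i := if i \in I then 0 else z i.
have x_neq0 : x != 0.
  apply/eqP => /rowP/(_ i0); rewrite !mxE Ii0 => /eqP.
  by rewrite (negPf (nz_z i0)).
have x_out i : i \notin I -> x 0 i = 0 by move=> /negPf iI; rewrite mxE iI.
set g := f \mPo shift (fun i => (x 0 i)%:MP).
have ord_g : ord_ge set0 m g by apply: ord_f.
pose g1 := \sum_(u <- msupp g)
  (g@_u * \prod_i y i ^+ u i) *: 'X^(mdeg u) : {poly K}.
pose g2 := \sum_(u <- msupp f)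
  (f@_u * \prod_i z i ^+ u i) *: 'X^(outdeg I u) : {poly K}.
have g1E t : g1.[t] = g.@[fun i => t * y i].
  rewrite mevalE horner_sum; apply: eq_bigr => u _.
  rewrite hornerZ hornerXn -mulrA; congr (_ * _).
  rewrite mdegE expr_sum -big_split; apply: eq_bigr => i _ /=.
  by rewrite exprMn mulrC.
have g2E t : g2.[t] = g.@[fun i => t * y i].
  rewrite comp_mpoly_meval mevalE horner_sum; apply: eq_bigr => u _.
  rewrite hornerZ hornerXn -mulrA; congr (_ * _).
  rewrite [outdeg _ _]big_mkcond expr_sum -big_split; apply: eq_bigr => i _ /=.
  rewrite tnth_mktuple mevalD mevalXU mevalC mxE inE /y.
  case: (i \in I) => /=; first by rewrite expr0 mulr1 mulr0 add0r.
  by rewrite addr0 exprMn mulrC.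
have eq_g : g1 = g2.
  apply/eqP; rewrite -subr_eq0; apply/negPn/negP => /poly_nonvanishing[j].
  by rewrite hornerD hornerN g1E g2E subrr eqxx.
case/negP: nz_fkz; apply/eqP.
have -> : fk.@[z] = g2`_k.
  rewrite raddf_sum coef_sum [LHS]big_mkcond; apply: eq_bigr => u _ /=.
  rewrite coefZ coefXn eq_sym; case: eqP => _; last by rewrite mulr0.
  by rewrite mulr1 mevalZ mevalX.
rewrite -eq_g coef_sum big_seq big1 // => u /ord_g; rewrite outdeg_set0 => le_mu.
by rewrite coefZ coefXn ltn_eqF ?mulr0 // (leq_trans ltkm).
Qed.

End Points.

(** * Effective classes and translation invariant forms *)

Section Pic.

Lemma Pic_mulz (x : Pic) (c : int) :
  x *~ c = (x.1 *~ c, [ffun J => x.2 J *~ c]).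
Proof.
have nat_case (y : Pic) k : y *+ k = (y.1 *+ k, [ffun J => y.2 J *+ k]).
  elim: k => [|k IHk].
    by rewrite !mulr0n; congr (_, _); apply/ffunP => J; rewrite !ffunE.
  rewrite mulrS IHk; case: y {IHk} => a b; congr (_, _); first by rewrite mulrS.
  by apply/ffunP => J; rewrite !ffunE mulrS.
case: c => k; first by rewrite -pmulrn nat_case.
rewrite NegzE mulrNz -pmulrn nat_case; congr (_, _).
by apply/ffunP => J; rewrite !ffunE mulrNz.
Qed.

Lemma sum_Ecl (c : center -> int) : \sum_I Ecl I *~ c I = (0, [ffun J => c J]).
Proof.
have fst_sum (G : center -> Pic) : (\sum_I G I).1 = \sum_I (G I).1.
  by apply: (big_morph (fun x : Pic => x.1)).
have snd_sum (G : center -> Pic) J : (\sum_I G I).2 J = \sum_I (G I).2 J.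
  apply: (big_morph (fun x : Pic => x.2 J)); last by rewrite ffunE.
  by move=> x y; rewrite ffunE.
rewrite [LHS]surjective_pairing; congr (_, _).
  by rewrite fst_sum big1 // => I _; rewrite Pic_mulz /= mul0rz.
apply/ffunP => J; rewrite snd_sum (bigD1 J) //= big1 ?addr0 => [|I].
  by rewrite Pic_mulz !ffunE eqxx intz.
by rewrite eq_sym Pic_mulz !ffunE => /negPf ->; rewrite mul0rz.
Qed.

Lemma class_coords (deg : nat) (c : center -> int) :
  Hcl *~ deg%:Z - \sum_I Ecl I *~ c I = (deg%:Z, [ffun I => - c I]).
Proof.
rewrite sum_Ecl Pic_mulz; congr (_, _); first by rewrite /= subr0 intz.
by apply/ffunP => I; rewrite !ffunE mul0rz add0r.
Qed.

End Pic.

Section InSupport.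
Variable K : fieldType.
Implicit Types (I : {set 'I_6}) (f : {mpoly K[6]}).

Definition max_indeg I (s : seq 'X_{1..6}) := (\max_(u <- s) \sum_(i in I) u i)%N.

Lemma in_outdeg I (u : 'X_{1..6}) : (\sum_(i in I) u i + outdeg I u = mdeg u)%N.
Proof.
rewrite mdegE [RHS](bigID (mem I)) /=; congr (_ + _)%N.
by apply: eq_bigl => i; rewrite inE.
Qed.

(** For a form, the degrees inside and outside I are complementary. *)
Lemma ord_geE I m f deg : f != 0 -> f \is deg.-homog ->
  ord_ge I m f <-> (m + max_indeg I (msupp f) <= deg)%N.
Proof.
move=> nz_f /dhomogP homf.
have degE u : u \in msupp f -> (\sum_(i in I) u i + outdeg I u = deg)%N.
  by move=> /homf <-; rewrite in_outdeg.
split=> [ord_f | le_m u uf]; last first.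
  have le_u : (\sum_(i in I) u i <= max_indeg I (msupp f))%N.
    exact: (@leq_bigmax_seq _ _ xpredT (fun u : 'X_{1..6} => \sum_(i in I) u i)%N).
  rewrite -(leq_add2l (\sum_(i in I) u i)) degE // addnC.
  by rewrite (leq_trans _ le_m) // leq_add2l.
have uf := mlead_supp nz_f.
have le_m : (m <= deg)%N by have := degE _ uf; have := ord_f _ uf; lia.
rewrite -leq_subRL //; apply/bigmax_leqP_seq => u {}uf _.
by have := degE _ uf; have := ord_f _ uf; lia.
Qed.

End InSupport.

Section Effective.
Variable K : fieldType.
Hypothesis charK : [pchar K] =i pred0.
Variable pt : 'M[K]_(6, 5).
Hypothesis gen_pt : general_position pt.

(** A relation that omits one point is a relation between five independent
    vectors. *)
Lemma relation_coord0 (w : 'rV[K]_6) i : w *m pt = 0 -> w 0 i = 0 -> w = 0.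
Proof.
move=> w_pt wi0.
have w'0 : col' i w *m row' i pt = 0.
  rewrite -w_pt; apply/rowP => j; rewrite !mxE [RHS](bigD1_ord i) //= wi0 mul0r add0r.
  by apply: eq_bigr => k _; rewrite !mxE.
have /rowP w'E : col' i w = 0.
  by apply/eqP; rewrite -(mulmx_free_eq0 _ (gen_pt i)) w'0.
apply/rowP => j; rewrite mxE; case: (unliftP i j) => [k|] -> //.
by have := w'E k; rewrite !mxE.
Qed.

Lemma exists_relation :
  exists2 w : 'rV[K]_6, w *m pt = 0 & forall i, w 0 i != 0.
Proof.
have /rowV0Pn[w /sub_kermxP w_pt nz_w] : kermx pt != 0.
  rewrite kermx_eq0 /row_free; apply/negP => /eqP rk.
  by have := rank_leq_col pt; rewrite rk.
exists w => // i; apply: contraNneq nz_w => wi0.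
by rewrite (relation_coord0 w_pt wi0).
Qed.

(** The rows of Q are the six points rescaled so that their sum vanishes. *)
Lemma exists_frame : exists Q : 'M[K]_(6, 5), exists R : 'M[K]_(5, 6),
  [/\ const_mx 1 *m Q = 0 :> 'rV_5,
      forall x : 'rV[K]_6, x *m Q = 0 -> x = const_mx (x 0 ord0),
      R *m Q = 1%:M &
      forall I v, in_span pt I v <->
        exists2 x : 'rV[K]_6, forall i, i \notin I -> x 0 i = 0 & v = x *m Q].
Proof.
have [w w_pt nz_w] := exists_relation.
pose Q := diag_mx w *m pt.
pose R := invmx (row' ord0 pt) *m
  rowsub (lift ord0) (diag_mx (\row_i (w 0 i)^-1)).
have Q_row i : row i Q = w 0 i *: row i pt.
  by rewrite row_mul row_diag_mx -scalemxAl -rowE.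
have QE x : x *m Q = (\row_i (x 0 i * w 0 i)) *m pt.
  rewrite mulmxA mul_mx_diag; congr (_ *m _); apply/rowP => i.
  by rewrite !mxE.
exists Q, R; split.
- by rewrite QE -[RHS]w_pt; congr (_ *m _); apply/rowP => i; rewrite !mxE mul1r.
- move=> x xQ0; set c := x 0 ord0.
  have : \row_i (x 0 i * w 0 i) - c *: w = 0.
    apply: (@relation_coord0 _ ord0); last by rewrite !mxE subrr.
    by rewrite mulmxBl -QE xQ0 -scalemxAl w_pt scaler0 subrr.
  move/rowP => xE; apply/rowP => i; have := xE i; rewrite !mxE -mulrBl.
  by move/eqP; rewrite mulf_eq0 (negPf (nz_w i)) orbF subr_eq0 => /eqP.
- have unit_pt : row' ord0 pt \in unitmx by rewrite -row_free_unit.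
  rewrite -mulmxA mul_rowsub_mx mulmxA.
  have -> : diag_mx (\row_i (w 0 i)^-1) *m diag_mx w = 1%:M.
    rewrite mulmx_diag -diag_const_mx; congr diag_mx; apply/rowP => i.
    by rewrite !mxE mulVf.
  by rewrite mul1mx -row'Esub mulVmx.
move=> I v; split=> [|[x x_out ->]]; last first.
  rewrite /in_span mulmx_sum_row; apply: summx_sub => i _.
  have [iI|/x_out ->] := boolP (i \in I); last by rewrite scale0r sub0mx.
  apply: (sumsmx_sup i) => //; rewrite genmxE Q_row.
  by rewrite !scalemx_sub.
case/sub_sumsmxP => a ->.
pose c i := (a i *m <<row i pt>>%MS *m pinvmx (row i pt)) 0 0.
have cE i : a i *m <<row i pt>>%MS = c i *: row i pt.
  rewrite -mul_scalar_mx -mx11_scalar mulmxKpV //.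
  by apply: submx_trans (submxMl _ _) _; rewrite genmxE.
exists (\row_i (if i \in I then c i / w 0 i else 0)).
  by move=> i /negPf iI; rewrite mxE iI.
rewrite mulmx_sum_row [LHS]big_mkcond; apply: eq_bigr => i _; rewrite mxE.
case: ifP => iI; last by rewrite scale0r.
by rewrite cE Q_row scalerA divfK.
Qed.

End Effective.

Section EffectiveP.
Variable K : fieldType.
Hypothesis charK : [pchar K] =i pred0.

Definition translation_invariant n (f : {mpoly K[n]}) : Prop :=
  forall ell : {mpoly K[n]}, f \mPo shift (fun=> ell) = f.

Variable pt : 'M[K]_(6, 5).
Hypothesis gen_pt : general_position pt.

Lemma mult_ge_atP (F : {mpoly K[5]}) v m :
  mult_ge_at F v m <-> ord_ge set0 m (translate v F).
Proof.
split=> [multF u | ordF u lt_um].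
  by rewrite mcoeff_msupp outdeg_set0 leqNgt; apply: contraNN => /multF ->.
apply/eqP; rewrite mcoeff_eq0; apply/negP => /ordF.
by rewrite outdeg_set0 leqNgt lt_um.
Qed.

(** At a point x Q of the span, with x supported on I, the expansion of [F] pulls
    back to the expansion of its pullback at x. Conversely a polynomial is
    recovered from its pullback by substituting R. *)
Lemma mult_ge_alongP (Q : 'M[K]_(6, 5)) (R : 'M[K]_(5, 6))
    (I : center) m (F : {mpoly K[5]}) :
  (forall x : 'rV[K]_6, x *m Q = 0 -> x = const_mx (x 0 ord0)) ->
  R *m Q = 1%:M ->
  (forall I v, in_span pt I v <->
     exists2 x : 'rV[K]_6, forall i, i \notin I -> x 0 i = 0 & v = x *m Q) ->
  mult_ge_along pt (val I) F m <-> ord_ge (val I) m (F \mPo linear_forms Q).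
Proof.
move=> kerQ RQ spanE; have /andP[I_gt0 I_le3] := valP I.
have [i1 i1I] : exists i, i \notin val I.
  apply/existsP; rewrite -negb_forall; apply/negP => /forallP allI.
  have : (#|[set: 'I_6]| <= #|val I|)%N by apply/subset_leq_card/subsetP => i _.
  by rewrite cardsT card_ord; apply/negP; rewrite -ltnNge (leq_ltn_trans I_le3).
split=> [multF | ordF v nz_v /spanE[x x_out v_def]].
  have /card_gt0P[i0 i0I] := I_gt0.
  apply: (ord_ge_points charK i0I) => x nz_x x_out.
  rewrite -translate_linear_forms; apply: ord_ge_comp => [j _|u].
    exact: ord_ge_linear_forms.
  rewrite -/(outdeg _ u); move: u; apply/mult_ge_atP/multF; last first.
    by apply/spanE; exists x.
  (* A nonzero x vanishing outside I is no multiple of (1, ..., 1). *)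
  apply: contraNneq nz_x => /kerQ x_const; apply/eqP/rowP => i.
  have x_all j : x 0 j = x 0 ord0 by rewrite {1}x_const mxE.
  by rewrite x_all -(x_all i1) x_out // mxE.
apply/mult_ge_atP.
have ord_shift : ord_ge set0 m (translate v F \mPo linear_forms Q).
  rewrite /translate v_def translate_linear_forms.
  apply: (@ord_ge_comp _ _ _ _ (val I)) ordF => i /x_out xi0.
  rewrite tnth_mktuple xi0 addr0 => u; rewrite msuppX inE => /eqP ->.
  by rewrite outdeg_set0 mdeg1.
rewrite -[translate v F]comp_mpoly_id -linear_forms1 -RQ -linear_formsM.
rewrite -comp_mpolyA; apply: ord_ge_comp ord_shift => i _.
exact: ord_ge_linear_forms.
Qed.

Lemma mult_alongP (Q : 'M[K]_(6, 5)) (R : 'M[K]_(5, 6))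
    (I : center) m (F : {mpoly K[5]}) deg :
  (forall x : 'rV[K]_6, x *m Q = 0 -> x = const_mx (x 0 ord0)) ->
  R *m Q = 1%:M ->
  (forall I v, in_span pt I v <->
     exists2 x : 'rV[K]_6, forall i, i \notin I -> x 0 i = 0 & v = x *m Q) ->
  F \mPo linear_forms Q != 0 -> F \is deg.-homog ->
  mult_along pt (val I) F m <->
  (m + max_indeg (val I) (msupp (F \mPo linear_forms Q)) = deg)%N.
Proof.
move=> kerQ RQ spanE nz_f homF.
have ordE k := ord_geE (val I) k nz_f (dhomog_linear_forms Q homF).
have multE k := mult_ge_alongP I k F kerQ RQ spanE.
split=> [[/multE/ordE le_m ltm] | eq_m].
  apply/eqP; rewrite eqn_leq le_m /= leqNgt; apply/negP => lt_m.
  by apply/ltm/multE/ordE; rewrite addSn.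
split; first by apply/multE/ordE; rewrite eq_m.
by move/multE/ordE; rewrite addSn eq_m ltnn.
Qed.

(** Pulling back by Q turns forms on K^5 into forms invariant under the kernel of
    Q; an invariant form in turn is pulled back from its substitution by R, as
    Q R differs from the identity by a multiple of (1, ..., 1). The exceptional
    part of an effective class turns the equation for the coefficients of the
    E_I into an inequality. *)
Theorem effectiveP (D : Pic) : effective pt D <->
  exists deg : nat, exists f : {mpoly K[6]},
    [/\ f != 0, f \is deg.-homog, translation_invariant f, D.1 = deg%:Z &
        forall I : center, (max_indeg (val I) (msupp f))%:Z <= D.2 I + deg%:Z].
Proof.
have [Q [R [onesQ kerQ RQ spanE]]] := exists_frame gen_pt.
split=> [[deg [F [mu [a [nz_F homF multF ->]]]]] | ].
  pose f := F \mPo linear_forms Q.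
  have nz_f : f != 0.
    apply: contraNneq nz_F => f0.
    rewrite -[F]comp_mpoly_id -linear_forms1 -RQ -linear_formsM -comp_mpolyA.
    by rewrite -/f f0 comp_mpoly0.
  exists deg, f; split=> //.
  - exact: dhomog_linear_forms.
  - move=> ell; rewrite comp_mpolyA; congr (F \mPo _).
    apply: eq_mktuple => j; rewrite tnth_mktuple raddf_sum /=.
    under eq_bigr => i _ do
      rewrite comp_mpolyZ comp_mpolyXi tnth_mktuple scalerDr.
    rewrite big_split /= -scaler_suml [X in X *: _](_ : _ = 0).
      by rewrite scale0r addr0.
    move/rowP: onesQ => /(_ j); rewrite !mxE => sum0; rewrite -[RHS]sum0.
    by apply: eq_bigr => i _; rewrite mxE mul1r.
  - by rewrite class_coords sum_Ecl /= addr0.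
  move=> I; rewrite class_coords sum_Ecl /= !ffunE.
  have /(mult_alongP I (mu I) kerQ RQ spanE nz_f homF) := multF I.
  by rewrite -/f => <-; move: (max_indeg _ _) (mu I) (a I) => x y z; lia.
move=> [deg [f [nz_f homf invf D1 D2]]].
pose F := f \mPo linear_forms R.
have fE : F \mPo linear_forms Q = f.
  rewrite /F comp_mpolyA linear_formsM.
  pose c i := (Q *m R - 1%:M) i ord0.
  have QRE i j : (Q *m R) i j = (i == j)%:R + c i.
    have /kerQ : row i (Q *m R - 1%:M) *m Q = 0.
      rewrite -row_mul mulmxBl -mulmxA RQ mulmx1 mul1mx subrr.
      by apply/rowP => k; rewrite !mxE.
    rewrite /c; move: (Q *m R) => A /rowP/(_ j); rewrite !mxE => rowE.
    by rewrite -rowE subrKC.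
  rewrite -[RHS](invf (\sum_i c i *: 'X_i)); congr (f \mPo _).
  apply: eq_mktuple => j.
  under eq_bigr => i _ do rewrite QRE scalerDl.
  rewrite big_split; congr (_ + _); rewrite (bigD1 j) //= eqxx scale1r big1.
    by rewrite addr0.
  by move=> i /negPf ->; rewrite scale0r.
pose mu (I : center) := (deg - max_indeg (val I) (msupp f))%N.
have le_max (I : center) : (max_indeg (val I) (msupp f) <= deg)%N.
  by apply/(ord_geE (val I) 0 nz_f homf).
have homF : F \is deg.-homog by apply: dhomog_linear_forms.
exists deg, F, mu, (fun I => absz (D.2 I + (mu I)%:Z)); split=> //.
- by apply: contraNneq nz_f => F0; rewrite -fE F0 comp_mpoly0.
- move=> I; apply/(mult_alongP I (mu I) kerQ RQ spanE _ homF); rewrite fE //.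
  by rewrite subnK.
rewrite class_coords sum_Ecl [D]surjective_pairing D1; congr (_, _).
  by rewrite addr0.
apply/ffunP => I; rewrite !ffunE /=.
have := D2 I; have := le_max I; rewrite /mu.
by move: (max_indeg _ _) (D.2 I) => x y; lia.
Qed.

End EffectiveP.

(** * Translation invariance and balancing *)

Section Tension.
Variable K : fieldType.
Variable n : nat.
Implicit Types (f : {mpoly K[n]}) (u v S : 'X_{1..n}).

Definition submul u S : nat := (\prod_(i < n) 'C(u i, S i))%N.

(** The coefficient of S in [f] after the translation by (1, ..., 1). *)
Definition tension f S : K := \sum_(u <- msupp f) f@_u * (submul u S)%:R.

Lemma submul_eq0 u S : (submul u S == 0%N) = ~~ (S <= u)%MM.
Proof.
rewrite /submul; apply/idP/idP => [|/negP nle].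
  apply: contraL => /mnm_lepP leSu; rewrite -lt0n.
  by apply: prodn_gt0 => i; rewrite bin_gt0 leSu.
apply/negPn/negP; rewrite -lt0n => gt0; apply/nle/mnm_lepP => i.
rewrite -bin_gt0 lt0n; apply: contraTneq gt0 => Ci0.
by rewrite (bigD1 i) //= Ci0 mul0n.
Qed.

Lemma mdeg_le u S : (S <= u)%MM -> mdeg u = (mdeg S + mdeg (u - S)%MM)%N.
Proof. by move=> leSu; rewrite -mdegD addmC submK. Qed.

Lemma submul_refl u : submul u u = 1%N.
Proof. by rewrite /submul big1 // => i _; rewrite binn. Qed.

Section Expand.
Variable deg : nat.

(** Exponents are bounded by the degree, so that sums over them are finite. *)
Definition mnm_ffun (s : {ffun 'I_n -> 'I_deg.+1}) : 'X_{1..n} :=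
  [multinom (s i : nat) | i < n].

Lemma sum_mnm_ffun (c : 'X_{1..n} -> K) v : (mdeg v <= deg)%N ->
  \sum_(s : {ffun 'I_n -> 'I_deg.+1}) c (mnm_ffun s) * (mnm_ffun s == v)%:R
  = c v.
Proof.
move=> le_v; pose s0 := [ffun i => inord (v i) : 'I_deg.+1].
have s0E : mnm_ffun s0 = v.
  apply/mnmP => i; rewrite mnmE ffunE inordK // ltnS (leq_trans _ le_v) //.
  by rewrite mdegE (bigD1 i) //= leq_addr.
rewrite (bigD1 s0) //= s0E eqxx mulr1 big1 ?addr0 // => s /negP ns.
case: eqP => [eq_s|]; last by rewrite mulr0.
case: ns; apply/eqP/ffunP => i; apply/val_inj => /=.
by rewrite -[LHS](mnmE (fun i => (s i : nat))) -/(mnm_ffun s) eq_s -s0E mnmE.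
Qed.

Lemma shift_expand f ell : f \is deg.-homog ->
  f \mPo shift (fun=> ell) =
  \sum_(s : {ffun 'I_n -> 'I_deg.+1})
    tension f (mnm_ffun s) *: (ell ^+ (deg - mdeg (mnm_ffun s)) * 'X_[mnm_ffun s]).
Proof.
move=> /dhomogP homf; rewrite comp_mpolyEX /tension.
under [RHS]eq_bigr => s _ do rewrite scaler_suml.
rewrite [RHS]exchange_big big_seq [RHS]big_seq; apply: eq_bigr => u uf /=.
under [RHS]eq_bigr => s _ do rewrite -scalerA.
rewrite -scaler_sumr; congr (_ *: _); rewrite comp_mpolyX.
have deg_u : mdeg u = deg := homf u uf.
have le_u i : (u i <= deg)%N by rewrite -deg_u mdegE (bigD1 i) //= leq_addr.
pose F i k := (ell ^+ (u i - k) * 'X_i ^+ k) *+ 'C(u i, k).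
rewrite (_ : \prod_i _ = \prod_i \sum_(k < deg.+1) F i k); last first.
  apply: eq_bigr => i _; rewrite tnth_mktuple addrC exprDn.
  rewrite (big_ord_widen _ (F i) (_ : (u i).+1 <= deg.+1)%N) ?ltnS //.
  rewrite big_mkcond; apply: eq_bigr => k _; rewrite ltnS.
  by case: leqP => // ltk; rewrite /F bin_small // mulr0n.
rewrite bigA_distr_bigA; apply: eq_bigr => s _ /=.
rewrite prodrMn (_ : (\prod_i _)%N = submul u (mnm_ffun s)); last first.
  by apply: eq_bigr => i _; rewrite mnmE.
have [leSu | nleSu] := boolP (mnm_ffun s <= u)%MM; last first.
  by rewrite -submul_eq0 in nleSu; rewrite (eqP nleSu) mulr0n scale0r.
rewrite scaler_nat; congr (_ *+ _); rewrite big_split /= [in RHS]mpolyXE_id.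
congr (_ * _); last by apply: eq_bigr => i _; rewrite mnmE.
rewrite -expr_sum -[X in (X - _)%N]deg_u !mdegE -sumnB => [|i _]; last exact/mnm_lepP.
by congr (_ ^+ _); apply: eq_bigr => i _; rewrite mnmE.
Qed.

Lemma tension_eq_mdeg f S : f \is deg.-homog -> (deg <= mdeg S)%N ->
  tension f S = f@_S.
Proof.
move=> /dhomogP homf le_S; rewrite /tension.
have other u : u \in msupp f -> u != S -> (submul u S)%:R = 0 :> K.
  move=> /homf deg_u nu; have /eqP -> // : submul u S == 0%N.
  rewrite submul_eq0; apply: contraNN nu => leSu.
  have := mdeg_le leSu; rewrite [mdeg u]deg_u => deg_eq.
  have /eqP : mdeg (u - S)%MM = 0%N by lia.
  by rewrite mdeg_eq0 => /eqP uS; rewrite -(submK leSu) uS add0m.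
have [Sf | nSf] := boolP (S \in msupp f); last first.
  rewrite (memN_msupp_eq0 nSf) big_seq big1 // => u uf.
  by rewrite other ?mulr0 //; apply: contraNneq nSf => <-.
rewrite (bigD1_seq S) //= submul_refl mulr1 big_seq_cond big1 ?addr0 //.
by move=> u /andP[uf nu]; rewrite other ?mulr0.
Qed.

(** Translation invariance is the balancing condition: expanding f(x + l) in
    powers of l, the coefficient of x^S is the tension at S times a power of
    l. *)
Lemma translation_invariantP f : f \is deg.-homog ->
  translation_invariant f <-> forall S, (mdeg S < deg)%N -> tension f S = 0.
Proof.
move=> homf; split=> [inv_f S lt_S | tension0 ell].
  have := congr1 (mcoeff S) (inv_f 1); rewrite shift_expand // raddf_sum /=.
  under eq_bigr => s _ do rewrite expr1n mul1r mcoeffZ mcoeffX.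
  rewrite sum_mnm_ffun ?(ltnW lt_S) // => ->.
  by rewrite (dhomog_nemf_coeff homf) // ltn_eqF.
rewrite shift_expand //.
have term S : tension f S *: (ell ^+ (deg - mdeg S) * 'X_[S]) = f@_S *: 'X_[S].
  have [lt_S | le_S] := ltnP (mdeg S) deg.
    by rewrite tension0 // (dhomog_nemf_coeff homf) ?ltn_eqF // !scale0r.
  by rewrite tension_eq_mdeg // (eqP le_S) mul1r.
under eq_bigr => s _ do rewrite term.
apply/mpolyP => v; rewrite raddf_sum /=.
under eq_bigr => s _ do rewrite mcoeffZ mcoeffX.
have [le_v | lt_v] := leqP (mdeg v) deg; first exact: (sum_mnm_ffun (fun w => f@_w)).
have fv0 : f@_v = 0 by rewrite (dhomog_nemf_coeff homf) // gtn_eqF.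
rewrite fv0 big1 // => s _; case: eqP => [->|]; last by rewrite mulr0.
by rewrite fv0 mul0r.
Qed.

End Expand.

(** The sum is the coefficient of S in the derivative of [f] in the direction
    (1, ..., 1), which vanishes by invariance. *)
Lemma sum_derivatives d f S : f \is d.+1.-homog -> translation_invariant f ->
  mdeg S = d -> \sum_i f@_(S + U_(i)) *+ (S i).+1 = 0.
Proof.
move=> homf /(translation_invariantP homf) tension0 deg_S.
rewrite -[RHS](tension0 S) ?deg_S // /tension.
have sub1 u : mdeg u = d.+1 ->
    submul u S = (\sum_i (u == S + U_(i))%MM * (S i).+1)%N.
  move=> deg_u; have [leSu | nle] := boolP (S <= u)%MM; last first.
    rewrite big1 => [|i _]; first by apply/eqP; rewrite submul_eq0.
    by case: eqP nle => // ->; rewrite lem_addr.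
  have : mdeg (u - S)%MM == 1%N.
    have := mdeg_le leSu; rewrite deg_u deg_S => /eqP.
    by rewrite -addn1 eqn_add2l eq_sym.
  case/mdeg1P => i /eqP uS.
  have uE : u = (S + U_(i))%MM by rewrite -uS addmC submK.
  rewrite (bigD1 i) //= uE eqxx mul1n big1 ?addn0 => [|j /negPf nj].
    rewrite /submul (bigD1 i) //= mnmDE mnm1E eqxx addn1 binSn big1 ?muln1 //.
    by move=> j nj; rewrite mnmDE mnm1E eq_sym (negPf nj) addn0 binn.
  case: eqP => // /addmI /mnmP/(_ i); rewrite !mnm1E eqxx nj.
  by [].
rewrite [RHS]big_seq.
under [RHS]eq_bigr => u uf.
  rewrite (sub1 _ (dhomog_mf homf uf)) natr_sum mulr_sumr; over.
rewrite [RHS]exchange_big; apply: eq_bigr => i _ /=.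
rewrite -big_seq; set v := (S + U_(i))%MM.
have [vf | nvf] := boolP (v \in msupp f); last first.
  rewrite (memN_msupp_eq0 nvf) mul0rn big_seq big1 // => u uf.
  by case: eqP => [uv|]; [rewrite -uv uf in nvf | rewrite mul0n mulr0].
rewrite (bigD1_seq v) //= eqxx mul1n mulr_natr big1 ?addr0 // => u /negPf ->.
by rewrite mul0n mulr0.
Qed.

End Tension.

Section Squarefree.
Variable K : fieldType.
Variable n : nat.
Implicit Types (f : {mpoly K[n]}) (A : {set 'I_n}).

Definition squarefree f := forall u, u \in msupp f -> forall i, (u i <= 1)%N.

Lemma squarefree_mesym1 (u : 'X_{1..n}) :
  (forall i, u i <= 1)%N -> u = mesym1 [set i | u i == 1%N].
Proof.
move=> le1; apply/mnmP => i; rewrite mnmE inE.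
by case: (u i) (le1 i) => [|[]].
Qed.

(** At the indicator of A only the monomials supported in A survive, and a
    squarefree one of degree at least the size of A fills A. *)
Lemma eval_indicator f deg A :
  squarefree f -> f \is deg.-homog -> (#|A| <= deg)%N ->
  f.@[fun i => (i \in A)%:R] = f@_(mesym1 A).
Proof.
move=> sqf homf le_A; rewrite mevalE.
have other u : u \in msupp f -> u != mesym1 A ->
    \prod_i (i \in A)%:R ^+ u i = 0 :> K.
  move=> uf nu; apply/eqP/prodf_eq0.
  suff /existsP[i /andP[iA ui]] : [exists i, (i \notin A) && (u i != 0%N)].
    by exists i => //; rewrite (negPf iA) expr0n (negPf ui).
  apply: contraNT nu => /existsPn no_i.
  have le_uA : (u <= mesym1 A)%MM.
    apply/mnm_lepP => i; rewrite mnmE; have := no_i i.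
    by case: (i \in A) => /=; rewrite ?(sqf _ uf) // negbK => /eqP ->.
  have /eqP : mdeg (mesym1 A - u)%MM = 0%N.
    have := mdeg_le le_uA; rewrite mdeg_mesym1 [mdeg u](dhomog_mf homf uf); lia.
  by rewrite mdeg_eq0 => /eqP A_u; rewrite -(submK le_uA) A_u add0m.
have [Af | nAf] := boolP (mesym1 A \in msupp f); last first.
  rewrite (memN_msupp_eq0 nAf) big_seq big1 // => u uf.
  by rewrite other ?mulr0 //; apply: contraNneq nAf => <-.
rewrite (bigD1_seq (mesym1 A)) //= big1 ?mulr1 => [|i _]; last first.
  by rewrite mnmE; case: (i \in A); rewrite ?expr0 ?expr1.
rewrite big_seq_cond big1 ?addr0 // => u /andP[uf nu].
by rewrite other ?mulr0.
Qed.

(** Evaluate [f] at the indicator of [A] and at its translate by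
    (-1, ..., -1), which is minus the indicator of the complement. *)
Lemma coef_setC f deg A :
  squarefree f -> f \is deg.-homog -> translation_invariant f ->
  (#|A| <= deg)%N -> (#|~: A| <= deg)%N ->
  f@_(mesym1 A) = (-1) ^+ deg * f@_(mesym1 (~: A)).
Proof.
move=> sqf homf invf leA leAC.
rewrite -!(eval_indicator sqf homf) // -[in LHS](invf (-1)) comp_mpoly_meval.
rewrite !mevalE mulr_sumr big_seq [RHS]big_seq; apply: eq_bigr => u uf.
rewrite mulrCA; congr (_ * _).
have <- : mdeg u = deg := dhomog_mf homf uf.
rewrite mdegE expr_sum -big_split; apply: eq_bigr => i _ /=.
rewrite tnth_mktuple mevalD mevalXU mevalN meval1 -exprMn inE.
by case: (i \in A); rewrite ?subrr ?mulr0 ?sub0r ?mulr1.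
Qed.

End Squarefree.

(** * Complexes as supports of invariant forms *)

Section Support.

Definition mnm_of (s : {mset 'I_6}) : 'X_{1..6} := [multinom s i | i < 6].

Definition monomials (Delta : {fset {mset 'I_6}}) : seq 'X_{1..6} :=
  [seq mnm_of s | s <- Delta].

Lemma mnm_of_inj : injective mnm_of.
Proof.
move=> s t /mnmP eq_st; apply/msetP => i.
by have := eq_st i; rewrite !mnmE.
Qed.

Lemma monomials_uniq Delta : uniq (monomials Delta).
Proof. by rewrite map_inj_uniq ?fset_uniq //; apply: mnm_of_inj. Qed.

Lemma mdeg_mnm_of s : mdeg (mnm_of s) = size s.
Proof.
rewrite mdegE size_mset [RHS]big_uniq ?fset_uniq //= [RHS]big_mkcond /=.
by apply: eq_bigr => i _; rewrite mnmE mem_finsupp; case: eqP.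
Qed.

Lemma mnm_of_surj (u : 'X_{1..6}) : exists s, mnm_of s = u.
Proof.
exists (seq_mset (flatten [seq nseq (u i) i | i <- enum 'I_6])).
apply/mnmP => i; rewrite mnmE mset_seqE count_flatten -map_comp sumnE.
rewrite big_map big_enum /= (bigD1 i) //= count_nseq /= eqxx mul1n.
by rewrite big1 ?addn0 // => j /negPf nj; rewrite count_nseq /= nj.
Qed.

Lemma submult_mnm_of (S s : {mset 'I_6}) : submult S s = submul (mnm_of s) (mnm_of S).
Proof. by apply: eq_bigr => i _; rewrite !mnmE. Qed.

Lemma submult_gt0 (S s : {mset 'I_6}) : (0 < submult S s)%N -> (S `<=` s)%mset.
Proof.
rewrite submult_mnm_of lt0n submul_eq0 negbK => /mnm_lepP le_S.
by apply/msubsetP => i; have := le_S i; rewrite !mnmE.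
Qed.

Variable K : fieldType.

(** The weights of a balanced complex are the coefficients of an invariant
    form. *)
Lemma balanceableP d (Delta : {fset {mset 'I_6}}) : is_complex d Delta ->
  balanceable K d Delta <->
  exists f : {mpoly K[6]}, [/\ f \is d.+1.-homog, translation_invariant f &
    msupp f =i monomials Delta].
Proof.
move=> complexD.
have deg_mon u : u \in monomials Delta -> mdeg u = d.+1.
  by case/mapP => s /complexD <- ->; rewrite mdeg_mnm_of.
have homE (f : {mpoly K[6]}) : msupp f =i monomials Delta -> f \is d.+1.-homog.
  by move=> suppf; apply/dhomogP => u; rewrite suppf => /deg_mon.
have tensionE (f : {mpoly K[6]}) S : msupp f =i monomials Delta ->
    tension f (mnm_of S) = \sum_(s <- Delta | (S `<=` s)%mset)
      f@_(mnm_of s) * (submult S s)%:R.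
  move=> suppf; rewrite /tension.
  rewrite (perm_big _ (uniq_perm (msupp_uniq f) (monomials_uniq Delta) suppf)).
  rewrite big_map [RHS]big_mkcond; apply: eq_bigr => s _ /=.
  rewrite submult_mnm_of; case: ifP => // nS.
  have := @submult_gt0 S s; rewrite nS submult_mnm_of.
  by case: (submul _ _) => [|k /(_ isT)]; rewrite ?mulr0.
split=> [[w [nz_w bal_w]] | [f [homf invf suppf]]].
  pose f : {mpoly K[6]} := \sum_(s <- Delta) w s *: 'X_[mnm_of s].
  have coef_f s : s \in Delta -> f@_(mnm_of s) = w s.
    move=> sD; rewrite raddf_sum (bigD1_seq s) ?fset_uniq //= mcoeffZ mcoeffX.
    rewrite eqxx mulr1 big1 ?addr0 // => t nt; rewrite mcoeffZ mcoeffX.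
    by rewrite (inj_eq mnm_of_inj) (negPf nt) mulr0.
  have suppf : msupp f =i monomials Delta.
    move=> u; apply/idP/idP => [|/mapP[s sD ->]]; last first.
      by rewrite mcoeff_msupp coef_f // nz_w.
    apply: contraLR => nu; rewrite -mcoeff_eq0 raddf_sum /= big_seq big1 //.
    move=> s sD; rewrite mcoeffZ mcoeffX; case: eqP => [su|]; last by rewrite mulr0.
    by case/negP: nu; apply/mapP; exists s.
  have homf := homE f suppf.
  exists f; split=> //; apply/(translation_invariantP homf) => u lt_u.
  have [S uS] := mnm_of_surj u; rewrite -uS tensionE //.
  rewrite -[RHS](bal_w S); last by rewrite -mdeg_mnm_of uS.
  rewrite big_seq_cond [RHS]big_seq_cond; apply: eq_bigr => s /andP[sD _].
  by rewrite coef_f.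
exists (fun s => f@_(mnm_of s)); split=> [s sD | S le_S].
  by rewrite -mcoeff_msupp suppf map_f.
rewrite -tensionE //; apply: ((translation_invariantP homf).1 invf).
by rewrite mdeg_mnm_of.
Qed.

End Support.

(** * Balanced graphs on six vertices *)

(* Decides the distinctness of a list of vertices from that of other lists. *)
Ltac distinct :=
  repeat match goal with
  | H : is_true (uniq (_ :: _)) |- _ => rewrite /= ?inE ?negb_or in H
  | H : is_true (_ && _) |- _ => case/andP: H => ? ?
  end;
  rewrite /= ?inE ?negb_or;
  repeat (apply/andP; split); try done;
  by [assumption | rewrite eq_sym; assumption].

Section Graph.
Variable K : fieldType.
Hypothesis charK : [pchar K] =i pred0.
Variable V : finType.
Hypothesis card_V : (#|V| <= 6)%N.
Variable e : V -> V -> K.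
Hypothesis e_sym : forall x y, e x y = e y x.
Hypothesis e_irr : forall x, e x x = 0.
Hypothesis e_sum : forall x, \sum_y e x y = 0.

Definition adj x y := e x y != 0.

Definition has_square := exists a b c d,
  [/\ uniq [:: a; b; c; d], adj a b, adj b c, adj c d & adj d a].

Definition has_bowtie := exists i j k p q,
  uniq [:: i; j; k; p; q] /\
  [/\ adj i j, adj i k & adj j k] /\ [/\ adj i p, adj i q & adj p q].

Definition has_hexagon := exists i j k p q r,
  uniq [:: i; j; k; p; q; r] /\
  [/\ adj i j, adj j k & adj k p] /\ [/\ adj p q, adj q r & adj r i].

Definition has_joined_triangles := exists i j k r p q,
  [/\ uniq [:: i; j; k; r; p; q], [/\ adj i j, adj i k & adj j k],
      [/\ adj r p, adj r q & adj p q] & adj i r].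

Lemma adj_sym x y : adj x y = adj y x. Proof. by rewrite /adj e_sym. Qed.

Lemma adj_neq x y : adj x y -> x != y.
Proof. by apply: contraNneq => ->; rewrite e_irr. Qed.

Lemma sum_neighbours x (s : seq V) : uniq s ->
  (forall y, adj x y -> y \in s) -> \sum_(y <- s) e x y = 0.
Proof.
move=> uniq_s only; rewrite big_uniq //= -[RHS](e_sum x) big_mkcond /=.
apply: eq_bigr => y _; case: ifPn => // ys.
by apply/esym/eqP; apply: contraNT ys; apply: only.
Qed.

Lemma sum_two_neighbours x a b : a != b ->
  (forall y, adj x y -> y \in [:: a; b]) -> e x a = - e x b.
Proof.
move=> nab /sum_neighbours; rewrite /= inE nab => /(_ isT).
by rewrite !big_cons big_nil addr0 => /eqP; rewrite addr_eq0 => /eqP.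
Qed.

Lemma second_neighbour x y : adj x y -> exists2 z, adj x z & z != y.
Proof.
move=> axy; have /exists_inP[z nzy axz] : [exists (z | z != y), adj x z].
  apply: contraT => /exists_inPn no_z; case/eqP: axy.
  rewrite -[RHS](e_sum x) (bigD1 y) //= big1 ?addr0 // => z nzy.
  by apply/eqP; have := no_z z nzy; rewrite negbK.
by exists z.
Qed.

(** Weights that alternate along an odd cycle satisfy w = - w. *)
Lemma eq_oppr0 (w : K) : w = - w -> w = 0.
Proof.
move/eqP; rewrite -addr_eq0 -mulr2n -mulr_natr mulf_eq0 (natr_eq0 charK).
by rewrite orbF => /eqP.
Qed.

Definition longest_path (s : seq V) :=
  [/\ uniq s, sorted adj s &
      forall t, uniq t -> sorted adj t -> (size t <= size s)%N].

Lemma longest_path_exists x y : adj x y ->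
  exists2 s, longest_path s & (1 < size s)%N.
Proof.
move=> axy; pose P k := [exists t : k.-tuple V, uniq t && sorted adj t].
have P2 : P 2%N.
  by apply/existsP; exists [tuple x; y]; rewrite /= inE adj_neq // axy.
have boundP k : P k -> (k <= 6)%N.
  case/existsP => t /andP[uniq_t _]; apply: leq_trans card_V.
  by rewrite -(size_tuple t) -(card_uniqP uniq_t) max_card.
have [k /existsP[t /andP[uniq_t path_t]] max_k] :=
  ex_maxnP (ex_intro (fun k => is_true (P k)) 2%N P2) boundP.
exists t; rewrite ?size_tuple ?max_k //; split=> // s uniq_s path_s.
rewrite size_tuple; apply: max_k; apply/existsP.
by exists (in_tuple s); rewrite uniq_s path_s.
Qed.

Lemma longest_path_same s t : longest_path s -> size t = size s ->
  uniq t -> sorted adj t -> longest_path t.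
Proof.
by move=> [_ _ max_s] eq_ts ut pt; split=> // r; rewrite eq_ts; apply: max_s.
Qed.

Lemma longest_path_rev s : longest_path s -> longest_path (rev s).
Proof.
move=> ls; have [us ps _] := ls.
apply: longest_path_same ls _ _ _; rewrite ?size_rev ?rev_uniq //.
by rewrite rev_sorted (eq_sorted (e' := adj)) // => x y; rewrite adj_sym.
Qed.

Lemma longest_path_head x s y : longest_path (x :: s) -> adj x y -> y \in s.
Proof.
move=> [us ps max_s] axy; apply/negPn/negP => ys.
have := max_s (y :: x :: s); rewrite /= inE negb_or ys andbT.
rewrite eq_sym adj_neq //= adj_sym axy ltnn => contra.
by have := contra us ps.
Qed.

Ltac edge := by [assumption | rewrite adj_sym; assumption].
Ltac configuration := repeat split; first [edge | distinct].

(** Each vertex of the triangle is an end of a longest path, hence has no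
    neighbours outside the triangle, and the weights alternate around it. *)
Lemma no_isolated_triangle a b c : longest_path [:: a; b; c] -> ~~ adj a c.
Proof.
move=> l; apply/negP => aac.
have [u /=] := l; rewrite andbT => /andP[ab bc] _.
have only_a z : adj a z -> z \in [:: b; c] by apply: longest_path_head.
have l' : longest_path [:: b; a; c].
  by apply: (longest_path_same l); rewrite //= ?aac 1?adj_sym ?ab //; distinct.
have l'' : longest_path [:: c; a; b].
  apply: (longest_path_same l); rewrite //= ?ab ?andbT; [by distinct | edge].
have eab : e a b = - e a c.
  by apply: sum_two_neighbours => //; distinct.
have eba : e b a = - e b c.
  by apply: sum_two_neighbours => [|z]; [distinct | apply: longest_path_head].
have eca : e c a = - e c b.
  by apply: sum_two_neighbours => [|z]; [distinct | apply: longest_path_head].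
case/eqP: ab; apply: eq_oppr0.
by rewrite {1}eab e_sym eca opprK e_sym -[e b c]opprK -eba e_sym.
Qed.

(** Rotations of the pentagon are longest paths too, so all neighbours of its
    vertices lie on it. A chord cuts off a square; without chords the weights
    alternate around the pentagon. *)
Lemma pentagon_square a b c d f : longest_path [:: a; b; c; d; f] ->
  adj a f -> has_square.
Proof.
have rot a1 a2 a3 a4 a5 : longest_path [:: a1; a2; a3; a4; a5] -> adj a1 a5 ->
    longest_path [:: a2; a3; a4; a5; a1] /\ adj a2 a1.
  move=> l a15; have [u /=] := l; rewrite andbT => /and4P[a12 a23 a34 a45] _.
  split; last by edge.
  apply: (longest_path_same l) => //; first by distinct.
  by rewrite /= a23 a34 a45 adj_sym a15.
have chord a1 a2 a3 a4 a5 : longest_path [:: a1; a2; a3; a4; a5] ->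
    adj a1 a5 -> has_square \/ e a1 a2 = - e a1 a5.
  move=> l a15; have [u /=] := l; rewrite andbT => /and4P[a12 a23 a34 a45] _.
  have [a13|n13] := boolP (adj a1 a3).
    by left; exists a1, a3, a4, a5; configuration.
  have [a14|n14] := boolP (adj a1 a4).
    by left; exists a1, a2, a3, a4; configuration.
  right; apply: sum_two_neighbours => [|z a1z]; first by distinct.
  have := longest_path_head l a1z; rewrite !inE.
  by case/or4P => /eqP zE; move: a1z; rewrite zE ?(negPf n13) ?(negPf n14) ?eqxx ?orbT.
move=> l1 af; have [u /=] := l1; rewrite andbT => /andP[ab _] _.
have [l2 ba] := rot _ _ _ _ _ l1 af.
have [l3 cb] := rot _ _ _ _ _ l2 ba.
have [l4 dc] := rot _ _ _ _ _ l3 cb.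
have [l5 fd] := rot _ _ _ _ _ l4 dc.
have [//|e1] := chord _ _ _ _ _ l1 af.
have [//|e2] := chord _ _ _ _ _ l2 ba.
have [//|e3] := chord _ _ _ _ _ l3 cb.
have [//|e4] := chord _ _ _ _ _ l4 dc.
have [//|e5] := chord _ _ _ _ _ l5 fd.
case/eqP: ab; apply: eq_oppr0.
rewrite {1}e1 e_sym e5 opprK e_sym e4 e_sym e3 opprK e_sym e2 e_sym.
by [].
Qed.

(** Each vertex of the support graph has degree at least two, so both ends of a
    longest path have a second neighbour on the path. The positions of these two
    neighbours give one of the four configurations, except when the path closes
    up to a triangle, which balancing excludes, or to a pentagon, which has a
    chord. *)
Theorem balanced_graph x y : adj x y ->
  [\/ has_square, has_bowtie, has_hexagon | has_joined_triangles].
Proof.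
move=> axy; have [s ls size_s] := longest_path_exists axy.
have size_s6 : (size s <= 6)%N.
  by have [us _ _] := ls; apply: leq_trans card_V; rewrite -(card_uniqP us) max_card.
have := longest_path_rev ls.
case: s ls size_s size_s6 => [|x1 [|x2 s]] // ls _.
have a12 : adj x1 x2 by have [_ /andP[]] := ls.
have [y1 a1 ny1] := second_neighbour a12.
have := longest_path_head ls a1; rewrite inE (negPf ny1) /=.
case: s ls => [|x3 [|x4 [|x5 [|x6 [|]]]]] // ls y1s _.
(* The longest path has three, four, five or six vertices. *)
- move: y1s; rewrite inE => /eqP y1E; subst y1.
  by have := no_isolated_triangle ls; rewrite a1.
- have [u /=] := ls; rewrite andbT => /and3P[_ a23 a34] _ rls.
  have a43 : adj x4 x3 by edge.
  have [y4 a4 ny4] := second_neighbour a43.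
  have := longest_path_head rls a4; rewrite !inE (negPf ny4) /= => y4s.
  apply: Or41; move: y1s; rewrite !inE => /orP[] /eqP y1E; subst y1.
    case/orP: y4s => /eqP y4E; subst y4.
      by exists x1, x3, x4, x2; configuration.
    by exists x1, x2, x3, x4; configuration.
  by exists x1, x2, x3, x4; configuration.
- have [u /=] := ls; rewrite andbT => /and4P[_ a23 a34 a45] _ rls.
  have a54 : adj x5 x4 by edge.
  have [y5 a5 ny5] := second_neighbour a54.
  have := longest_path_head rls a5; rewrite !inE (negPf ny5) /= => y5s.
  move: y1s; rewrite !inE => /or3P[] /eqP y1E; subst y1.
  + case/or3P: y5s => /eqP y5E; subst y5.
    * by apply: Or42; exists x3, x1, x2, x4, x5; configuration.
    * by apply: Or41; exists x2, x3, x4, x5; configuration.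
    * by apply: Or41; apply: (pentagon_square ls); edge.
  + by apply: Or41; exists x1, x2, x3, x4; configuration.
  + by apply: Or41; apply: (pentagon_square ls); edge.
have [u /=] := ls; rewrite andbT => /and5P[_ a23 a34 a45 a56] _ rls.
have a65 : adj x6 x5 by edge.
have [y6 a6 ny6] := second_neighbour a65.
have := longest_path_head rls a6; rewrite !inE (negPf ny6) /= => y6s.
have hexagon z1 z2 z3 z4 z5 z6 : uniq [:: z1; z2; z3; z4; z5; z6] ->
    adj z1 z2 -> adj z2 z3 -> adj z3 z4 -> adj z4 z5 -> adj z5 z6 ->
    adj z6 z1 -> has_hexagon.
  by move=> *; exists z1, z2, z3, z4, z5, z6.
have square z1 z2 z3 z4 : uniq [:: z1; z2; z3; z4] ->
    adj z1 z2 -> adj z2 z3 -> adj z3 z4 -> adj z4 z1 -> has_square.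
  by move=> *; exists z1, z2, z3, z4.
move: y1s; rewrite !inE => /or4P[] /eqP y1E; subst y1;
  case/or4P: y6s => /eqP y6E; subst y6.
- apply: Or44; exists x3, x1, x2, x4, x5, x6; configuration.
- by apply: Or41; apply: (square x3 x4 x5 x6); configuration.
- by apply: Or43; apply: (hexagon x1 x3 x4 x5 x6 x2); configuration.
- by apply: Or43; apply: (hexagon x1 x2 x3 x4 x5 x6); configuration.
- by apply: Or41; apply: (square x1 x2 x3 x4); configuration.
- by apply: Or41; apply: (square x1 x2 x3 x4); configuration.
- by apply: Or41; apply: (square x1 x2 x3 x4); configuration.
- by apply: Or41; apply: (square x1 x2 x3 x4); configuration.
- by apply: Or43; apply: (hexagon x6 x4 x3 x2 x1 x5); configuration.
- by apply: Or41; apply: (square x6 x3 x4 x5); configuration.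
- by apply: Or41; apply: (square x6 x2 x1 x5); configuration.
- by apply: Or43; apply: (hexagon x1 x2 x3 x4 x5 x6); configuration.
- by apply: Or43; apply: (hexagon x1 x2 x3 x4 x5 x6); configuration.
- by apply: Or43; apply: (hexagon x1 x2 x3 x4 x5 x6); configuration.
- by apply: Or43; apply: (hexagon x1 x2 x3 x4 x5 x6); configuration.
- by apply: Or43; apply: (hexagon x1 x2 x3 x4 x5 x6); configuration.
Qed.

Lemma adj_two_neighbours x a b : a != b ->
  (forall y, adj x y -> y \in [:: a; b]) -> adj x a = adj x b.
Proof.
by move=> nab /(sum_two_neighbours nab); rewrite /adj => ->; rewrite oppr_eq0.
Qed.

(** Weights are opposite on the two edges at a vertex of degree two; going around
    the hexagon, one nonzero weight makes all of them nonzero. *)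
Lemma hexagon_circuit i j k p q r : uniq [:: i; j; k; p; q; r] ->
  (forall y, adj i y -> y \in [:: j; r]) ->
  (forall y, adj j y -> y \in [:: i; k]) ->
  (forall y, adj k y -> y \in [:: j; p]) ->
  (forall y, adj p y -> y \in [:: k; q]) ->
  (forall y, adj q y -> y \in [:: p; r]) ->
  [/\ adj j k = adj i j, adj k p = adj i j, adj p q = adj i j,
      adj q r = adj i j & adj r i = adj i j].
Proof.
move=> u /adj_two_neighbours ni /adj_two_neighbours nj /adj_two_neighbours nk.
move=> /adj_two_neighbours np /adj_two_neighbours nq.
have ejk : adj j k = adj i j by rewrite -nj 1?adj_sym //; distinct.
have ekp : adj k p = adj i j by rewrite -nk 1?adj_sym ?ejk //; distinct.
have epq : adj p q = adj i j by rewrite -np 1?adj_sym ?ekp //; distinct.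
have eqr : adj q r = adj i j by rewrite -nq 1?adj_sym ?epq //; distinct.
by split=> //; rewrite adj_sym -ni //; distinct.
Qed.

Lemma end_triangle i j k : uniq [:: i; j; k] ->
  (forall y, adj j y -> y \in [:: i; k]) ->
  (forall y, adj k y -> y \in [:: i; j]) ->
  [/\ e i k = e i j, adj i k = adj i j & adj j k = adj i j].
Proof.
move=> u nj nk.
have eji : e j i = - e j k by apply: sum_two_neighbours nj; distinct.
have eki : e k i = - e k j by apply: sum_two_neighbours nk; distinct.
have eik : e i k = e i j by rewrite e_sym eki e_sym -eji e_sym.
by rewrite /adj eik -[e j k]opprK -eji oppr_eq0 e_sym.
Qed.

Lemma two_neq0 : 2%:R != 0 :> K. Proof. by rewrite (natr_eq0 charK). Qed.

(** The two edges of each triangle at the common vertex have equal weights, so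
    these weights are opposite for the two triangles. *)
Lemma bowtie_circuit i j k p q : uniq [:: i; j; k; p; q] ->
  (forall y, adj i y -> y \in [:: j; k; p; q]) ->
  (forall y, adj j y -> y \in [:: i; k]) ->
  (forall y, adj k y -> y \in [:: i; j]) ->
  (forall y, adj p y -> y \in [:: i; q]) ->
  (forall y, adj q y -> y \in [:: i; p]) ->
  [/\ adj i k = adj i j, adj j k = adj i j, adj i p = adj i j,
      adj i q = adj i j & adj p q = adj i j].
Proof.
move=> u ni nj nk np nq.
have [|eik aik ajk] := end_triangle _ nj nk; first by distinct.
have [|eiq aiq apq] := end_triangle _ np nq; first by distinct.
suff aip : adj i p = adj i j by rewrite aiq apq aip.
have : \sum_(y <- [:: j; k; p; q]) e i y = 0.
  by apply: sum_neighbours ni; distinct.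
rewrite !big_cons big_nil eik eiq => sum0.
have : (e i j + e i p) * 2%:R = 0 by rewrite -[RHS]sum0; ring.
move/eqP; rewrite mulf_eq0 (negPf two_neq0) orbF addr_eq0 => /eqP eij.
by rewrite /adj eij oppr_eq0.
Qed.

(** The joining edge has minus twice the weight of the triangle edges at either
    of its ends. *)
Lemma joined_triangles_circuit i j k r p q : uniq [:: i; j; k; r; p; q] ->
  (forall y, adj i y -> y \in [:: j; k; r]) ->
  (forall y, adj j y -> y \in [:: i; k]) ->
  (forall y, adj k y -> y \in [:: i; j]) ->
  (forall y, adj r y -> y \in [:: p; q; i]) ->
  (forall y, adj p y -> y \in [:: r; q]) ->
  (forall y, adj q y -> y \in [:: r; p]) ->
  [/\ adj i k = adj i j, adj j k = adj i j, adj i r = adj i j &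
      [/\ adj r p = adj i j, adj r q = adj i j & adj p q = adj i j]].
Proof.
move=> u ni nj nk nr np nq.
have [|eik aik ajk] := end_triangle _ nj nk; first by distinct.
have [|erq arq apq] := end_triangle _ np nq; first by distinct.
have joined x a b y : uniq [:: a; b; y] -> e x b = e x a ->
    (forall z, adj x z -> z \in [:: a; b; y]) -> adj x y = adj x a.
  move=> uab exb /(sum_neighbours uab); rewrite !big_cons big_nil exb => sum0.
  have -> : adj x a = (e x a * 2%:R != 0) by rewrite mulf_eq0 (negPf two_neq0) orbF.
  suff -> : e x a * 2%:R = - e x y by rewrite oppr_eq0.
  by apply/eqP; rewrite -addr_eq0 -sum0; apply/eqP; ring.
have air : adj i r = adj i j by apply: joined eik ni; distinct.
have arp : adj r p = adj i j.
  by rewrite -air [RHS]adj_sym; apply/esym/(joined _ _ _ _ _ erq nr); distinct.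
by split=> //; rewrite arq apq arp.
Qed.

End Graph.

(** * Links of invariant forms *)

Notation mon2 x y := (U_(x) + U_(y))%MM.
Notation mon3 x y z := (U_(x) + U_(y) + U_(z))%MM.

Section Monomials.
Variable n : nat.
Implicit Types x y z a b c : 'I_n.

Lemma mnm1_eq x a : (U_(x) == U_(a))%MM = (x == a).
Proof.
apply/eqP/eqP => [/mnmP/(_ x)|-> //]; rewrite !mnm1E eqxx.
by case: eqP => // ->.
Qed.

Lemma mon2_eq x y a b :
  (mon2 x y == mon2 a b) = (x == a) && (y == b) || (x == b) && (y == a).
Proof.
apply/eqP/orP => [eq_m | [] /andP[/eqP -> /eqP ->] //]; last exact: addmC.
have : (a == x) || (b == x).
  by move/mnmP/(_ x): eq_m; rewrite !mnmDE !mnm1E eqxx; do 3 case: (_ == x).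
case/orP => /eqP xE; rewrite xE in eq_m *.
  by move/addmI/eqP: eq_m; rewrite mnm1_eq; left; rewrite eqxx.
rewrite [RHS]addmC in eq_m.
by move/addmI/eqP: eq_m; rewrite mnm1_eq; right; rewrite eqxx.
Qed.

Lemma mon3_eq x y z a b c :
  (mon3 x y z == mon3 a b c) =
  [|| (x == a) && (mon2 y z == mon2 b c), (x == b) && (mon2 y z == mon2 a c) |
      (x == c) && (mon2 y z == mon2 a b)].
Proof.
apply/eqP/or3P => [eq_m | [] /andP[/eqP -> /eqP/mnmP yz]]; last first.
- by apply/mnmP => i; have := yz i; rewrite !mnmDE; lia.
- by apply/mnmP => i; have := yz i; rewrite !mnmDE; lia.
- by apply/mnmP => i; have := yz i; rewrite !mnmDE; lia.
have : [|| a == x, b == x | c == x].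
  by move/mnmP/(_ x): eq_m; rewrite !mnmDE !mnm1E eqxx; do 5 case: (_ == x).
case/or3P => /eqP xE; rewrite -xE eqxx /=; [apply: Or31|apply: Or32|apply: Or33].
all: apply/eqP/mnmP => i; move/mnmP/(_ i): eq_m; rewrite !mnmDE xE; lia.
Qed.

Lemma mdeg_mon2 x y : mdeg (mon2 x y) = 2%N.
Proof. by rewrite mdegD !mdeg1. Qed.

Lemma mdeg_mon3 x y z : mdeg (mon3 x y z) = 3%N.
Proof. by rewrite mdegD mdeg_mon2 mdeg1. Qed.

Lemma mdeg1E (u : 'X_{1..n}) : mdeg u = 1%N -> exists x, u = U_(x)%MM.
Proof. by move/eqP/mdeg1P => [x /eqP ->]; exists x. Qed.

Lemma mdegS_split d (u : 'X_{1..n}) : mdeg u = d.+1 ->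
  exists x v, u = (U_(x) + v)%MM /\ mdeg v = d.
Proof.
move=> deg_u; have : mdeg u != 0%N by rewrite deg_u.
rewrite mdegE sum_nat_eq0 negb_forall => /existsP[x /= ux].
have le_x : (U_(x) <= u)%MM by rewrite lep1mP.
exists x, (u - U_(x))%MM; rewrite addmC submK //; split=> //.
by have := mdeg_le le_x; rewrite deg_u mdeg1 => -[->].
Qed.

Lemma mdeg2E (u : 'X_{1..n}) : mdeg u = 2%N -> exists x y, u = mon2 x y.
Proof.
move/mdegS_split => [x [v [-> /mdeg1E[y ->]]]]; by exists x, y.
Qed.

Lemma mdeg3E (u : 'X_{1..n}) : mdeg u = 3%N -> exists x y z, u = mon3 x y z.
Proof.
move/mdegS_split => [x [v [-> /mdeg2E[y [z ->]]]]]; exists x, y, z.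
by rewrite addmA.
Qed.

(** Faces are stored as tuples of vertices, so that neighbours in a link are
    found by filtering a list. *)
Definition edge_monomials (es : seq ('I_n * 'I_n)) : seq 'X_{1..n} :=
  [seq mon2 e.1 e.2 | e <- es].

Definition face_monomials (ts : seq ('I_n * 'I_n * 'I_n)) : seq 'X_{1..n} :=
  [seq mon3 t.1.1 t.1.2 t.2 | t <- ts].

Definition neighbours x (es : seq ('I_n * 'I_n)) : seq 'I_n :=
  flatten [seq (if e.1 == x then [:: e.2] else [::]) ++
               (if e.2 == x then [:: e.1] else [::]) | e <- es].

Definition link_edges x (ts : seq ('I_n * 'I_n * 'I_n)) : seq ('I_n * 'I_n) :=
  flatten [seq (if t.1.1 == x then [:: (t.1.2, t.2)] else [::]) ++
               (if t.1.2 == x then [:: (t.1.1, t.2)] else [::]) ++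
               (if t.2 == x then [:: (t.1.1, t.1.2)] else [::]) | t <- ts].

Lemma mem_neighbours x y es : mon2 x y \in edge_monomials es -> y \in neighbours x es.
Proof.
case/mapP => e es_e /eqP; rewrite mon2_eq => xye; apply/flatten_mapP; exists e => //.
rewrite mem_cat; case/orP: xye => /andP[/eqP -> /eqP ->].
  by rewrite eqxx inE eqxx ?orbT.
by rewrite eqxx inE eqxx ?orbT.
Qed.

Lemma mem_link_edges x y z ts :
  mon3 x y z \in face_monomials ts -> mon2 y z \in edge_monomials (link_edges x ts).
Proof.
case/mapP => t ts_t /eqP; rewrite mon3_eq => yzt.
suff [e te /eqP ->] : exists2 e, e \in link_edges x ts & mon2 y z == mon2 e.1 e.2.
  by apply/mapP; exists e.
by case/or3P: yzt => /andP[/eqP -> yz]; [exists (t.1.2, t.2) | exists (t.1.1, t.2) |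
  exists (t.1.1, t.1.2)] => //; apply/flatten_mapP; exists t => //;
  rewrite !mem_cat eqxx inE eqxx ?orbT.
Qed.

End Monomials.

Section Link.
Variable K : fieldType.
Hypothesis charK : [pchar K] =i pred0.
Variable n : nat.
Implicit Types (f : {mpoly K[n]}) (S : 'X_{1..n}).

Definition link f S x y : K := f@_(S + mon2 x y).

Variable f : {mpoly K[n]}.
Variable S : 'X_{1..n}.
Hypothesis sqf : squarefree f.

Lemma squarefree_coef0 (u : 'X_{1..n}) x : (1 < u x)%N -> f@_u = 0.
Proof.
by move=> gt1; apply: memN_msupp_eq0; apply: contraL gt1 => /sqf; rewrite -leqNgt.
Qed.

Lemma link_sym x y : link f S x y = link f S y x.
Proof. by rewrite /link [mon2 x y]addmC. Qed.

Lemma link_irr x : link f S x x = 0.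
Proof. by apply: (@squarefree_coef0 _ x); rewrite !mnmDE mnm1E eqxx; lia. Qed.

(** On the link of S, invariance says that the weights of the edges at each
    vertex sum to zero. *)
Lemma link_sum x : f \is (mdeg S).+2.-homog -> translation_invariant f ->
  \sum_y link f S x y = 0.
Proof.
move=> homf invf.
rewrite -[RHS](sum_derivatives homf invf (S := (S + U_(x))%MM)); last first.
  by rewrite mdegD mdeg1 addn1.
apply: eq_bigr => y _; rewrite /link addmA.
case E : ((S + U_(x))%MM y) => [|k]; first by rewrite mulr1n.
rewrite (@squarefree_coef0 _ y) ?mul0rn //.
by rewrite mnmDE E mnm1E eqxx; lia.
Qed.

End Link.

(** * Invariant forms built from differences of variables *)

Section Forms.
Variable K : fieldType.
Hypothesis charK : [pchar K] =i pred0.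
Variable n : nat.
Implicit Types (f g : {mpoly K[n]}) (s : seq 'X_{1..n}) (i j k p q r : 'I_n).

Definition diff i j : {mpoly K[n]} := 'X_i - 'X_j.

Lemma invariant_diff i j : translation_invariant (diff i j).
Proof.
move=> ell; rewrite /diff comp_mpolyB !comp_mpolyXi !tnth_mktuple.
by rewrite opprD addrACA subrr addr0.
Qed.

Lemma invariantD f g : translation_invariant f -> translation_invariant g ->
  translation_invariant (f + g).
Proof. by move=> invf invg ell; rewrite comp_mpolyD invf invg. Qed.

Lemma invariantB f g : translation_invariant f -> translation_invariant g ->
  translation_invariant (f - g).
Proof. by move=> invf invg ell; rewrite comp_mpolyB invf invg. Qed.

Lemma invariantM f g : translation_invariant f -> translation_invariant g ->
  translation_invariant (f * g).
Proof. by move=> invf invg ell; rewrite rmorphM /= invf invg. Qed.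

Lemma homog_diff i j : diff i j \is 1.-homog.
Proof. by rewrite rpredB // dhomogX /= mdeg1. Qed.

Lemma mem_msuppD f g s :
  {subset msupp f <= s} -> {subset msupp g <= s} -> {subset msupp (f + g) <= s}.
Proof.
by move=> sf sg u /msuppD_le; rewrite mem_cat => /orP[/sf|/sg].
Qed.

Lemma mem_msuppB f g s :
  {subset msupp f <= s} -> {subset msupp g <= s} -> {subset msupp (f - g) <= s}.
Proof.
by move=> sf sg u /msuppB_le; rewrite mem_cat => /orP[/sf|/sg].
Qed.

Lemma mem_msuppZ c f s : {subset msupp f <= s} -> {subset msupp (c *: f) <= s}.
Proof. by move=> sf u /msuppZ_le; apply: sf. Qed.

Lemma mem_msuppX u s : u \in s -> {subset msupp ('X_[u] : {mpoly K[n]}) <= s}.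
Proof. by move=> us v; rewrite msuppX inE => /eqP ->. Qed.

Lemma msupp_diff i j : {subset msupp (diff i j) <= [:: U_(i)%MM; U_(j)%MM]}.
Proof. by apply: mem_msuppB; apply: mem_msuppX; rewrite !inE eqxx ?orbT. Qed.

Lemma msuppM_diff i j f u : u \in msupp (diff i j * f) ->
  exists2 v, v \in msupp f & u = (U_(i) + v)%MM \/ u = (U_(j) + v)%MM.
Proof.
move/msuppM_le/allpairsP => [[u1 v] [/= /msupp_diff + vf ->]].
by rewrite !inE => /orP[] /eqP ->; exists v; auto.
Qed.

Lemma diff_neq0 i j : i != j -> diff i j != 0.
Proof.
move=> nij; apply/eqP => /(congr1 (mcoeff U_(i)%MM)) /eqP.
by rewrite mcoeffB !mcoeffXU eqxx (eq_sym j) (negPf nij) mcoeff0 subr0 oner_eq0.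
Qed.

(** These forms weigh the edges or faces of the circuits below; written in
    differences of variables they are visibly invariant. *)
Definition form_hexagon i j k p q r : {mpoly K[n]} :=
  diff i k * diff j p + diff i q * diff p r.

Definition form_bowtie i j k p q : {mpoly K[n]} :=
  diff i p * diff i q - diff i j * diff i k.

Definition form_joined i j k r p q : {mpoly K[n]} :=
  diff i r * diff i r - diff i j * diff i k - diff r p * diff r q.

Definition form_neighbourly i1 i2 i3 i4 i5 i6 : {mpoly K[n]} :=
  diff i6 i2 * (diff i5 i4 * diff i1 i3) +
  diff i6 i1 * (diff i5 i3 * diff i4 i2).

Lemma form_hexagonP i j k p q r :
  translation_invariant (form_hexagon i j k p q r) /\
  form_hexagon i j k p q r \is 2.-homog.
Proof.
split.
  by apply: invariantD; apply: invariantM; apply: invariant_diff.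
by apply: rpredD; apply: (@dhomogM _ _ _ 1 _ 1); apply: homog_diff.
Qed.

Lemma form_bowtieP i j k p q :
  translation_invariant (form_bowtie i j k p q) /\
  form_bowtie i j k p q \is 2.-homog.
Proof.
split.
  by apply: invariantB; apply: invariantM; apply: invariant_diff.
by apply: rpredB; apply: (@dhomogM _ _ _ 1 _ 1); apply: homog_diff.
Qed.

Lemma form_joinedP i j k r p q :
  translation_invariant (form_joined i j k r p q) /\
  form_joined i j k r p q \is 2.-homog.
Proof.
split.
  by apply: invariantB; [apply: invariantB|]; apply: invariantM; apply: invariant_diff.
by apply: rpredB; [apply: rpredB|]; apply: (@dhomogM _ _ _ 1 _ 1); apply: homog_diff.
Qed.

Lemma form_neighbourlyP i1 i2 i3 i4 i5 i6 :
  translation_invariant (form_neighbourly i1 i2 i3 i4 i5 i6) /\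
  form_neighbourly i1 i2 i3 i4 i5 i6 \is 3.-homog.
Proof.
split.
  by apply: invariantD; do 2 (apply: invariantM; first exact: invariant_diff);
     apply: invariant_diff.
apply: rpredD; apply: (@dhomogM _ _ _ 1 _ 2); try exact: homog_diff.
  by apply: (@dhomogM _ _ _ 1 _ 1); apply: homog_diff.
by apply: (@dhomogM _ _ _ 1 _ 1); apply: homog_diff.
Qed.

(* Shows that the monomials of an explicit linear combination are in a list. *)
Ltac expand_support :=
  repeat first [apply: mem_msuppB | apply: mem_msuppD | apply: mem_msuppZ];
  apply: mem_msuppX; rewrite !inE !eqxx ?orbT //.

Lemma msupp_hexagon i j k p q r : {subset msupp (form_hexagon i j k p q r) <=
  [:: mon2 i j; mon2 j k; mon2 k p; mon2 p q; mon2 q r; mon2 r i]}.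
Proof.
have -> : form_hexagon i j k p q r = 'X_[mon2 i j] - 'X_[mon2 j k]
    + 'X_[mon2 k p] - 'X_[mon2 p q] + 'X_[mon2 q r] - 'X_[mon2 r i].
  by rewrite /form_hexagon /diff !mpolyXD; ring.
by expand_support.
Qed.

Lemma msupp_bowtie i j k p q : {subset msupp (form_bowtie i j k p q) <=
  [:: mon2 i j; mon2 i k; mon2 j k; mon2 i p; mon2 i q; mon2 p q]}.
Proof.
have -> : form_bowtie i j k p q = 'X_[mon2 i j] + 'X_[mon2 i k]
    - 'X_[mon2 j k] - 'X_[mon2 i p] - 'X_[mon2 i q] + 'X_[mon2 p q].
  by rewrite /form_bowtie /diff !mpolyXD; ring.
by expand_support.
Qed.

Lemma msupp_joined i j k r p q : {subset msupp (form_joined i j k r p q) <=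
  [:: mon2 i j; mon2 i k; mon2 j k; mon2 r p; mon2 r q; mon2 p q; mon2 i r]}.
Proof.
have -> : form_joined i j k r p q = 'X_[mon2 i j] + 'X_[mon2 i k]
    - 'X_[mon2 j k] + 'X_[mon2 r p] + 'X_[mon2 r q] - 'X_[mon2 p q]
    - 2%:R *: 'X_[mon2 i r].
  by rewrite /form_joined /diff !mpolyXD scaler_nat; ring.
by expand_support.
Qed.

Lemma msupp_neighbourly i1 i2 i3 i4 i5 i6 :
  {subset msupp (form_neighbourly i1 i2 i3 i4 i5 i6) <=
  [:: mon3 i1 i2 i3; mon3 i1 i2 i4; mon3 i1 i3 i4; mon3 i1 i4 i5;
      mon3 i1 i4 i6; mon3 i1 i5 i6; mon3 i2 i3 i4; mon3 i2 i3 i5;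
      mon3 i2 i3 i6; mon3 i2 i5 i6; mon3 i3 i5 i6; mon3 i4 i5 i6]}.
Proof.
have -> : form_neighbourly i1 i2 i3 i4 i5 i6 =
    'X_[mon3 i1 i5 i6] - 'X_[mon3 i3 i5 i6] - 'X_[mon3 i1 i4 i6]
    + 'X_[mon3 i2 i3 i5] + 'X_[mon3 i1 i2 i4] - 'X_[mon3 i2 i3 i4]
    + 'X_[mon3 i4 i5 i6] - 'X_[mon3 i2 i5 i6] + 'X_[mon3 i2 i3 i6]
    - 'X_[mon3 i1 i4 i5] + 'X_[mon3 i1 i3 i4] - 'X_[mon3 i1 i2 i3].
  by rewrite /form_neighbourly /diff !mpolyXD; ring.
by expand_support.
Qed.

End Forms.

(** * The minimal supports *)

Section SquarefreeMonomials.
Variable K : fieldType.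
Implicit Types (f : {mpoly K[6]}).

(** The sets of monomials that contain the support of a nonzero invariant form are
    the dependent sets of a matroid; s is either a circuit or independent. *)
Definition circuit d (s : seq 'X_{1..6}) := forall f, f != 0 ->
  f \is d.-homog -> translation_invariant f ->
  {subset msupp f <= s} -> msupp f =i s.

Lemma mon2_squarefree (x y : 'I_6) : uniq [:: x; y] -> forall i, (mon2 x y i <= 1)%N.
Proof.
rewrite /= inE andbT => nxy i; rewrite mnmDE !mnm1E; move: nxy.
by case: (x =P i) => [->|_]; case: (y =P i) => [->|_]; rewrite ?eqxx.
Qed.

Lemma mon3_squarefree (x y z : 'I_6) : uniq [:: x; y; z] ->
  forall i, (mon3 x y z i <= 1)%N.
Proof.
rewrite /= !inE negb_or andbT => /andP[/andP[nxy nxz] nyz] i.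
rewrite !mnmDE !mnm1E; move: nxy nxz nyz.
by case: (x =P i) => [->|_]; case: (y =P i) => [->|_];
  case: (z =P i) => [->|_]; rewrite ?eqxx.
Qed.

Lemma adj_link f S x y : adj (link f S) x y = ((S + mon2 x y)%MM \in msupp f).
Proof. by rewrite mcoeff_msupp. Qed.

Lemma adj_link0 f x y : adj (link f 0) x y = (mon2 x y \in msupp f).
Proof. by rewrite adj_link add0m. Qed.

Lemma card_I6 : (#|'I_6| <= 6)%N. Proof. by rewrite card_ord. Qed.

End SquarefreeMonomials.

(* Turns the distinctness of a list into equations between booleans. *)
Ltac disequations :=
  repeat match goal with
  | H : is_true (uniq (_ :: _)) |- _ => rewrite /= ?inE ?negb_or in H
  | H : is_true (_ && _) |- _ => case/andP: H => ? ?
  | H : is_true (?a != ?b) |- _ =>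
      let _ := constr:(a : 'I_6) in let H1 := fresh "neq" in let H2 := fresh "neq" in
      have H1 := negbTE H; have H2 : (b == a) = false by [rewrite eq_sym];
      clear H
  end.

Ltac simpl_disequations :=
  repeat match goal with
  | E : (?a == ?b) = false |- context [?a == ?b] => rewrite E
  end; rewrite ?eqxx.

(* Splits a membership in an explicit list into its cases. *)
Ltac list_cases H := rewrite !inE in H; repeat (case/orP: H => H).

(* Finds the neighbours of a vertex in an explicit list of edges. *)
Ltac find_neighbours sub :=
  let y := fresh "y" in let H := fresh "mem" in
  move=> y; rewrite ?adj_link0 ?adj_link ?addmA => /sub;
  try move/mem_link_edges; move/mem_neighbours; rewrite /link_edges /neighbours /=;
  simpl_disequations; rewrite /=; simpl_disequations; rewrite /= => H;
  first [exact: H | by list_cases H; rewrite !inE H ?orbT].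

Section GraphCircuits.
Variable K : fieldType.
Hypothesis charK : [pchar K] =i pred0.
Implicit Types (f : {mpoly K[6]}).

Definition squarefree_list (s : seq 'X_{1..6}) :=
  forall m, m \in s -> forall i, (m i <= 1)%N.

Lemma sub_squarefree f s : {subset msupp f <= s} -> squarefree_list s -> squarefree f.
Proof. by move=> sub sqs m /sub; apply: sqs. Qed.

Lemma graph_sum0 f : squarefree f -> f \is 2.-homog -> translation_invariant f ->
  forall x, \sum_y link f 0 x y = 0.
Proof. by move=> sqf homf invf x; apply: link_sum; rewrite ?mdeg0. Qed.

Lemma circuitP (s : seq 'X_{1..6}) f : f != 0 -> {subset msupp f <= s} ->
  (forall m, m \in s -> m \in msupp f -> {subset s <= msupp f}) ->
  msupp f =i s.
Proof.
move=> nz_f sub all_s m; apply/idP/idP => [/sub // | ms].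
have lf := mlead_supp nz_f; exact: all_s (sub _ lf) lf _ ms.
Qed.

Definition hexagon (i j k p q r : 'I_6) :=
  edge_monomials [:: (i, j); (j, k); (k, p); (p, q); (q, r); (r, i)].

Definition bowtie (i j k p q : 'I_6) :=
  edge_monomials [:: (i, j); (i, k); (j, k); (i, p); (i, q); (p, q)].

Definition joined_triangles (i j k r p q : 'I_6) :=
  edge_monomials [:: (i, j); (i, k); (j, k); (r, p); (r, q); (p, q); (i, r)].

Lemma edges_squarefree (es : seq ('I_6 * 'I_6)) :
  all (fun e => e.1 != e.2) es -> squarefree_list (edge_monomials es).
Proof.
move=> /allP ne _ /mapP[e /ne nex ->]; apply: mon2_squarefree.
by rewrite /= inE nex.
Qed.

Lemma hexagon_squarefree i j k p q r : uniq [:: i; j; k; p; q; r] ->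
  squarefree_list (hexagon i j k p q r).
Proof. by move=> u; apply: edges_squarefree; distinct. Qed.

Lemma bowtie_squarefree i j k p q : uniq [:: i; j; k; p; q] ->
  squarefree_list (bowtie i j k p q).
Proof. by move=> u; apply: edges_squarefree; distinct. Qed.

Lemma joined_triangles_squarefree i j k r p q : uniq [:: i; j; k; r; p; q] ->
  squarefree_list (joined_triangles i j k r p q).
Proof. by move=> u; apply: edges_squarefree; distinct. Qed.

Lemma circuit_hexagon i j k p q r : uniq [:: i; j; k; p; q; r] ->
  circuit K 2 (hexagon i j k p q r).
Proof.
move=> u f nz_f homf invf sub.
have sqf := sub_squarefree sub (@hexagon_squarefree _ _ _ _ _ _ u).
have sum0 := graph_sum0 sqf homf invf.
have := hexagon_circuit (link_sym f 0) sum0 u.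
disequations; case; [by find_neighbours sub .. |]; rewrite !adj_link0 => e1 e2 e3 e4 e5.
apply: (circuitP nz_f sub) => m mem mf m' mem'.
have mf' : mon2 i j \in msupp f.
  by list_cases mem; rewrite (eqP mem) ?e1 ?e2 ?e3 ?e4 ?e5 in mf.
by list_cases mem'; rewrite (eqP mem') ?e1 ?e2 ?e3 ?e4 ?e5.
Qed.

Lemma circuit_bowtie i j k p q : uniq [:: i; j; k; p; q] ->
  circuit K 2 (bowtie i j k p q).
Proof.
move=> u f nz_f homf invf sub.
have sqf := sub_squarefree sub (@bowtie_squarefree _ _ _ _ _ u).
have sum0 := graph_sum0 sqf homf invf.
have := bowtie_circuit charK (link_sym f 0) sum0 u.
disequations; case; [by find_neighbours sub .. |]; rewrite !adj_link0 => e1 e2 e3 e4 e5.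
apply: (circuitP nz_f sub) => m mem mf m' mem'.
have mf' : mon2 i j \in msupp f.
  by list_cases mem; rewrite (eqP mem) ?e1 ?e2 ?e3 ?e4 ?e5 in mf.
by list_cases mem'; rewrite (eqP mem') ?e1 ?e2 ?e3 ?e4 ?e5.
Qed.

Lemma circuit_joined i j k r p q : uniq [:: i; j; k; r; p; q] ->
  circuit K 2 (joined_triangles i j k r p q).
Proof.
move=> u f nz_f homf invf sub.
have sqf := sub_squarefree sub (@joined_triangles_squarefree _ _ _ _ _ _ u).
have sum0 := graph_sum0 sqf homf invf.
have := joined_triangles_circuit charK (link_sym f 0) sum0 u.
disequations; case; [by find_neighbours sub .. |].
rewrite !adj_link0 => e1 e2 e3 [e4 e5 e6].
apply: (circuitP nz_f sub) => m mem mf m' mem'.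
have mf' : mon2 i j \in msupp f.
  by list_cases mem; rewrite (eqP mem) ?e1 ?e2 ?e3 ?e4 ?e5 ?e6 in mf.
by list_cases mem'; rewrite (eqP mem') ?e1 ?e2 ?e3 ?e4 ?e5 ?e6.
Qed.

End GraphCircuits.

Section TripleCircuit.
Variable K : fieldType.
Hypothesis charK : [pchar K] =i pred0.
Implicit Types (f : {mpoly K[6]}).

Lemma all_six (s : seq 'I_6) : uniq s -> size s = 6 -> forall x, x \in s.
Proof.
move=> us size_s x.
have sub : {subset s <= enum 'I_6} by move=> y _; rewrite mem_enum.
have [|_ ->] := uniq_min_size us sub; last by rewrite mem_enum.
by rewrite size_s size_enum_ord.
Qed.

Lemma mesym1_mon3 (a b c : 'I_6) : uniq [:: a; b; c] ->
  mesym1 [set a; b; c] = mon3 a b c.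
Proof.
move=> u; apply/mnmP => i; rewrite mnmE !inE !mnmDE !mnm1E.
rewrite !(eq_sym i); disequations.
case: (a =P i) => [<-|_]; first by simpl_disequations.
by case: (b =P i) => [<-|_]; simpl_disequations.
Qed.

(** In degree three, complementary coefficients are opposite. *)
Lemma complement_msupp f a b c d e g : squarefree f -> f \is 3.-homog ->
  translation_invariant f -> uniq [:: a; b; c; d; e; g] ->
  (mon3 a b c \in msupp f) = (mon3 d e g \in msupp f).
Proof.
move=> sqf homf invf u.
have abc : mesym1 [set a; b; c] = mon3 a b c by apply: mesym1_mon3; distinct.
have deg : mesym1 [set d; e; g] = mon3 d e g by apply: mesym1_mon3; distinct.
have compl : ~: [set a; b; c] = [set d; e; g].
  apply/setP => x; have := all_six u erefl x; rewrite !inE; disequations.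
  by do ![case/orP]; move/eqP => ->; simpl_disequations.
have := coef_setC (A := [set a; b; c]) sqf homf invf.
rewrite compl -!mdeg_mesym1 abc deg !mdeg_mon3 => /(_ isT isT) coef_f.
by rewrite !mcoeff_msupp coef_f mulf_eq0 signr_eq0.
Qed.

Definition neighbourly_faces (i1 i2 i3 i4 i5 i6 : 'I_6) :=
  [:: (i1, i2, i3); (i1, i2, i4); (i1, i3, i4); (i1, i4, i5);
      (i1, i4, i6); (i1, i5, i6); (i2, i3, i4); (i2, i3, i5);
      (i2, i3, i6); (i2, i5, i6); (i3, i5, i6); (i4, i5, i6)].

Definition neighbourly i1 i2 i3 i4 i5 i6 :=
  face_monomials (neighbourly_faces i1 i2 i3 i4 i5 i6).

Lemma neighbourly_squarefree i1 i2 i3 i4 i5 i6 : uniq [:: i1; i2; i3; i4; i5; i6] ->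
  squarefree_list (neighbourly i1 i2 i3 i4 i5 i6).
Proof.
move=> u _ /mapP[t t_in ->]; apply: mon3_squarefree.
have /allP/(_ t t_in)/and3P[n12 n13 n23] : all
    (fun t : 'I_6 * 'I_6 * 'I_6 => [&& t.1.1 != t.1.2, t.1.1 != t.2 & t.1.2 != t.2])
    (neighbourly_faces i1 i2 i3 i4 i5 i6).
  by rewrite /neighbourly_faces; distinct.
by rewrite /= !inE negb_or n12 n13 n23.
Qed.

(** The link of i6 is a pair of triangles sharing i5, and the faces avoiding i6
    are the complements of those containing it. *)
Lemma circuit_neighbourly i1 i2 i3 i4 i5 i6 : uniq [:: i1; i2; i3; i4; i5; i6] ->
  circuit K 3 (neighbourly i1 i2 i3 i4 i5 i6).
Proof.
move=> u f nz_f homf invf sub.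
have sqf : squarefree f.
  exact: sub_squarefree sub (neighbourly_squarefree u).
have sum0 x : \sum_y link f U_(i6) x y = 0 by apply: link_sum; rewrite ?mdeg1.
have compl := complement_msupp sqf homf invf.
have c123 : (mon3 i1 i2 i3 \in msupp f) = (mon3 i4 i5 i6 \in msupp f).
  by apply: compl.
have c124 : (mon3 i1 i2 i4 \in msupp f) = (mon3 i3 i5 i6 \in msupp f).
  by apply: compl; distinct.
have c134 : (mon3 i1 i3 i4 \in msupp f) = (mon3 i2 i5 i6 \in msupp f).
  by apply: compl; distinct.
have c145 : (mon3 i1 i4 i5 \in msupp f) = (mon3 i2 i3 i6 \in msupp f).
  by apply: compl; distinct.
have c234 : (mon3 i2 i3 i4 \in msupp f) = (mon3 i1 i5 i6 \in msupp f).
  by apply: compl; distinct.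
have c235 : (mon3 i2 i3 i5 \in msupp f) = (mon3 i1 i4 i6 \in msupp f).
  by apply: compl; distinct.
have := @bowtie_circuit _ charK _ (link f U_(i6)) (link_sym f _) sum0 i5 i1 i4 i2 i3.
rewrite /neighbourly /neighbourly_faces in sub *; disequations.
case; [by rewrite /= !inE; simpl_disequations | by find_neighbours sub .. |].
rewrite !adj_link ![(U_(i6) + _)%MM]addmC ![mon2 i5 _]addmC => e1 e2 e3 e4 e5.
apply: (circuitP nz_f sub) => m mem mf m' mem'.
have mf' : mon3 i1 i5 i6 \in msupp f.
  by list_cases mem; rewrite (eqP mem) ?c123 ?c124 ?c134 ?c145 ?c234 ?c235
    ?e1 ?e2 ?e3 ?e4 ?e5 in mf.
by list_cases mem'; rewrite (eqP mem') ?c123 ?c124 ?c134 ?c145 ?c234 ?c235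
  ?e1 ?e2 ?e3 ?e4 ?e5.
Qed.

(** This distinguishes the complex from an octahedron, whose opposite vertices
    lie in no common face. *)
Lemma neighbourly_pair i1 i2 i3 i4 i5 i6 a b :
  uniq [:: i1; i2; i3; i4; i5; i6] -> a != b ->
  exists2 m, m \in neighbourly i1 i2 i3 i4 i5 i6 & (1 < m a + m b)%N.
Proof.
move=> u nab; have all6 := all_six u erefl.
pose joined x y := exists2 m, m \in neighbourly i1 i2 i3 i4 i5 i6 & (1 < m x + m y)%N.
have joined_sym x y : joined x y -> joined y x.
  by move=> [m mC lt_m]; exists m => //; rewrite addnC.
have face x y z : (x, y, z) \in neighbourly_faces i1 i2 i3 i4 i5 i6 ->
    [/\ joined x y, joined x z & joined y z].
  move=> t_in; have mC : mon3 x y z \in neighbourly i1 i2 i3 i4 i5 i6.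
    by apply/mapP; exists (x, y, z).
  by split; exists (mon3 x y z) => //; rewrite !mnmDE !mnm1E !eqxx; lia.
have [|j12 j13 j23] := face i1 i2 i3; first by rewrite !in_cons eqxx.
have [|_ j14 j24] := face i1 i2 i4; first by rewrite !in_cons eqxx ?orbT.
have [|_ _ j34] := face i1 i3 i4; first by rewrite !in_cons eqxx ?orbT.
have [|_ j15 j45] := face i1 i4 i5; first by rewrite !in_cons eqxx ?orbT.
have [|_ j16 j46] := face i1 i4 i6; first by rewrite !in_cons eqxx ?orbT.
have [|_ _ j56] := face i1 i5 i6; first by rewrite !in_cons eqxx ?orbT.
have [|_ j25 j35] := face i2 i3 i5; first by rewrite !in_cons eqxx ?orbT.
have [|_ j26 j36] := face i2 i3 i6; first by rewrite !in_cons eqxx ?orbT.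
change (joined a b); move: nab.
have := all6 a; rewrite !inE; do ![case/orP]; move/eqP => ->;
  have := all6 b; rewrite !inE; do ![case/orP]; move/eqP => -> => nab.
all: by [rewrite eqxx in nab | assumption | apply: joined_sym].
Qed.

End TripleCircuit.

Section NonzeroForms.
Variable K : fieldType.
Implicit Types i j k p q r : 'I_6.

Lemma meval_diff (v : 'I_6 -> K) (i j : 'I_6) : (diff K i j).@[v] = v i - v j.
Proof. by rewrite mevalB !mevalXU. Qed.

Lemma neq0_of_eval (f : {mpoly K[6]}) v : f.@[v] = 1 -> f != 0.
Proof. by apply: contra_eq_neq => ->; rewrite meval0 eq_sym oner_neq0. Qed.

Lemma form_hexagon_neq0 i j k p q r : uniq [:: i; j; k; p; q; r] ->
  form_hexagon K i j k p q r != 0.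
Proof.
move=> u; apply: (@neq0_of_eval _ (fun x : 'I_6 => ((x == i) || (x == j))%:R)).
rewrite mevalD !mevalM !meval_diff; disequations; simpl_disequations.
by rewrite /= ?subr0 ?mulr0 ?addr0 mulr1.
Qed.

Lemma form_bowtie_neq0 i j k p q : uniq [:: i; j; k; p; q] ->
  form_bowtie K i j k p q != 0.
Proof.
move=> u; apply: (@neq0_of_eval _ (fun x : 'I_6 => ((x == i) || (x == j))%:R)).
rewrite mevalB !mevalM !meval_diff; disequations; simpl_disequations.
by rewrite /= subrr !subr0 mul0r subr0 mulr1.
Qed.

Lemma form_joined_neq0 i j k r p q : uniq [:: i; j; k; r; p; q] ->
  form_joined K i j k r p q != 0.
Proof.
move=> u; apply: (@neq0_of_eval _ (fun x : 'I_6 => ((x == i) || (x == j))%:R)).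
rewrite !mevalB !mevalM !meval_diff; disequations; simpl_disequations.
by rewrite /= subrr !subr0 !mul0r !subr0 mulr1.
Qed.

Lemma form_neighbourly_neq0 (i1 i2 i3 i4 i5 i6 : 'I_6) :
  uniq [:: i1; i2; i3; i4; i5; i6] ->
  form_neighbourly K i1 i2 i3 i4 i5 i6 != 0.
Proof.
move=> u; apply: (@neq0_of_eval _ (fun x : 'I_6 => [|| x == i1, x == i5 | x == i6]%:R)).
rewrite mevalD !mevalM !meval_diff; disequations; simpl_disequations.
by rewrite /= subrr !subr0 mul0r addr0 !mulr1.
Qed.

End NonzeroForms.

(** * Irreducible classes *)

Section Classes.
Implicit Types I : {set 'I_6}.

(** The class of the strict transform of an invariant form with these monomials. *)
Definition class_of (deg : nat) (s : seq 'X_{1..6}) : Pic :=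
  (deg%:Z, [ffun I : center => (max_indeg (val I) s)%:Z - deg%:Z]).

Lemma complex_classE d Delta :
  complex_class d Delta = class_of d.+1 (monomials Delta).
Proof.
rewrite /complex_class class_coords; congr (_, _); apply/ffunP => I.
rewrite !ffunE opprB; congr (_%:Z - _); rewrite /max_indeg big_map.
by apply: eq_bigr => s _; apply: eq_bigr => i _; rewrite mnmE.
Qed.

Lemma leq_max_indeg I (s : seq 'X_{1..6}) u :
  u \in s -> (\sum_(i in I) u i <= max_indeg I s)%N.
Proof.
move=> us.
by apply: (@leq_bigmax_seq _ _ xpredT (fun u : 'X_{1..6} => \sum_(i in I) u i)%N).
Qed.

Lemma max_indeg_leq I (s : seq 'X_{1..6}) b :
  (forall u, u \in s -> (\sum_(i in I) u i <= b)%N) -> (max_indeg I s <= b)%N.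
Proof. by move=> le_b; apply/bigmax_leqP_seq => u us _; apply: le_b. Qed.

Lemma max_indeg_sub I (s t : seq 'X_{1..6}) :
  {subset s <= t} -> (max_indeg I s <= max_indeg I t)%N.
Proof. by move=> sub; apply: max_indeg_leq => u /sub; apply: leq_max_indeg. Qed.

Lemma max_indeg_attained I (s : seq 'X_{1..6}) u0 : u0 \in s ->
  exists2 u, u \in s & (\sum_(i in I) u i = max_indeg I s)%N.
Proof.
move=> u0s; have /hasP[u us /eqP <-] : has (fun u : 'X_{1..6} =>
    (\sum_(i in I) u i)%N == max_indeg I s) s; last by exists u.
apply: contraT => /hasPn neq_max.
have lt_max u : u \in s -> (\sum_(i in I) u i < max_indeg I s)%N.
  by move=> us; rewrite ltn_neqAle neq_max // leq_max_indeg.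
have gt0 : (0 < max_indeg I s)%N by apply: leq_trans (lt_max _ u0s).
suff : (max_indeg I s <= (max_indeg I s).-1)%N by rewrite -ltnS prednK // ltnn.
by apply: max_indeg_leq => u us; rewrite -ltnS prednK // lt_max.
Qed.

Lemma eq_class_of deg (s t : seq 'X_{1..6}) :
  s =i t -> class_of deg s = class_of deg t.
Proof.
move=> eq_st; congr (_, _); apply/ffunP => I; rewrite !ffunE; congr (_%:Z - _).
by apply/eqP; rewrite eqn_leq !max_indeg_sub // => u; rewrite eq_st.
Qed.

Variable K : fieldType.
Hypothesis charK : [pchar K] =i pred0.
Variable pt : 'M[K]_(6, 5).
Hypothesis gen_pt : general_position pt.

Let effP := effectiveP charK gen_pt.

(** Equations of effective divisors of P^4, pulled back to K^6. *)
Definition invariant_form deg (f : {mpoly K[6]}) :=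
  [/\ f != 0, f \is deg.-homog & translation_invariant f].

Lemma invariant_form1 : invariant_form 0 1.
Proof.
by split; [exact: oner_neq0 | exact: dhomog1 | move=> ell; rewrite comp_mpoly1].
Qed.

Lemma effective_form deg f (D : Pic) : invariant_form deg f -> D.1 = deg%:Z ->
  (forall I : center, (max_indeg (val I) (msupp f))%:Z <= D.2 I + deg%:Z) ->
  effective pt D.
Proof. by move=> [nz_f homf invf] D1 D2; apply/effP; exists deg, f. Qed.

(** Maximizing the degree in I over the supports of [f] and [g] separately gives a
    product of monomials in the complex; so the class of the complex minus the
    class of [f] is the class of [g] plus exceptional divisors. Irreducibility
    makes this difference zero. *)
Lemma class_split d Delta deg1 deg2 f g :
  irreducible_class pt (complex_class d Delta) ->
  invariant_form deg1 f -> invariant_form deg2 g ->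
  (0 < deg1)%N -> (deg1 + deg2 = d.+1)%N ->
  (forall u v, u \in msupp f -> v \in msupp g -> (u + v)%MM \in monomials Delta) ->
  deg2 = 0%N /\ complex_class d Delta = class_of deg1 (msupp f).
Proof.
move=> [_ _ irrD] Ff Fg deg1_gt0 degE sum_in; rewrite complex_classE in irrD *.
set D := class_of _ _ in irrD *; pose A := class_of deg1 (msupp f).
have [nz_f homf invf] := Ff; have [nz_g homg invg] := Fg.
have effA : effective pt A.
  by apply: (effective_form Ff) => // I; rewrite ffunE subrK.
have effB : effective pt (D - A).
  apply: (effective_form Fg) => [|I]; first by rewrite /= -degE; lia.
  rewrite !ffunE.
  have [u uf <-] := max_indeg_attained (val I) (mlead_supp nz_f).
  have [v vg <-] := max_indeg_attained (val I) (mlead_supp nz_g).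
  have := leq_max_indeg (val I) (sum_in u v uf vg).
  rewrite (eq_bigr (fun i => u i + v i)%N) => [|i _]; last by rewrite mnmDE.
  rewrite big_split /= -degE.
  by move: (\sum_(i in _) u i)%N (\sum_(i in _) v i)%N (max_indeg _ _); clear; lia.
have [|A0|/eqP] := irrD A (D - A) effA effB; first by rewrite addrC subrK.
  by have := congr1 fst A0; rewrite /= => -[]; lia.
rewrite subr_eq0 => /eqP DA; split=> //.
by have := congr1 fst DA; rewrite /= => -[]; lia.
Qed.

Lemma class_of_subform d Delta f :
  irreducible_class pt (complex_class d Delta) -> invariant_form d.+1 f ->
  {subset msupp f <= monomials Delta} ->
  complex_class d Delta = class_of d.+1 (msupp f).
Proof.
move=> irrD Ff sub.
have [] // := class_split irrD Ff invariant_form1 _ (addn0 _).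
move=> u v /sub uD; rewrite msupp1 inE => /eqP ->.
by rewrite addm0.
Qed.

Lemma no_product d Delta deg1 deg2 f g :
  irreducible_class pt (complex_class d Delta) ->
  invariant_form deg1 f -> invariant_form deg2 g ->
  (0 < deg1)%N -> (0 < deg2)%N -> (deg1 + deg2 = d.+1)%N ->
  (forall u v, u \in msupp f -> v \in msupp g -> (u + v)%MM \in monomials Delta) ->
  False.
Proof.
move=> irrD Ff Fg gt1 gt2 degE sum_in.
by have [deg2_0] := class_split irrD Ff Fg gt1 degE sum_in; rewrite deg2_0 in gt2.
Qed.

(** Compare the multiplicities along the span of the points occurring in u + v,
    of which there are at most three: some monomial of s involves only these
    points, and being squarefree of the same degree it is u + v. *)
Lemma sum_support d (s : seq 'X_{1..6}) (f g : {mpoly K[6]}) :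
  (d <= 2)%N -> (forall m, m \in s -> mdeg m = d.+1 /\ forall i, (m i <= 1)%N) ->
  (forall I : center, (max_indeg (val I) (msupp f) + max_indeg (val I) (msupp g)
     <= max_indeg (val I) s)%N) ->
  forall u v, u \in msupp f -> v \in msupp g -> mdeg (u + v) = d.+1 ->
  (u + v)%MM \in s.
Proof.
move=> le_d2 s_sqf le_max u v uf vg; set m := (u + v)%MM => deg_m.
pose I := [set i | m i != 0%N].
have sum_I : (\sum_(i in I) m i = d.+1)%N.
  rewrite -deg_m mdegE [RHS](bigID (mem I)) /= [X in (_ + X)%N]big1 ?addn0 //.
  by move=> i; rewrite inE negbK => /eqP.
have cardI_le : (#|I| <= d.+1)%N.
  by rewrite -sum_I -sum1_card leq_sum // => i; rewrite inE lt0n.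
have cardI_gt0 : (0 < #|I|)%N.
  rewrite lt0n; apply/eqP => /cards0_eq I0.
  by move: sum_I; rewrite I0 big_set0.
have I_center : (0 < #|I| <= 3)%N by rewrite cardI_gt0 (leq_trans cardI_le).
pose c : center := Sub I I_center.
have le_s : (d.+1 <= max_indeg I s)%N.
  apply: leq_trans (le_max c); rewrite SubK -sum_I.
  rewrite (eq_bigr (fun i => u i + v i)%N) => [|i _]; last by rewrite mnmDE.
  by rewrite big_split leq_add // leq_max_indeg.
have /hasP[w ws _] : has xpredT s.
  by case: s {s_sqf le_max} le_s => // ; rewrite /max_indeg big_nil.
have [{ws}w ws sum_w] := max_indeg_attained I ws.
rewrite -sum_w in le_s; have [deg_w le1] := s_sqf w ws.
have w1 : forall i, i \in I -> w i = 1%N.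
  move=> i iI; apply/eqP; rewrite eqn_leq le1 /= lt0n; apply/negP => /eqP wi0.
  suff : (\sum_(i in I) w i < #|I|)%N.
    by rewrite ltnNge (leq_trans cardI_le).
  rewrite -sum1_card (bigD1 i) //= [X in (_ < X)%N](bigD1 i) //= wi0.
  by rewrite add0n add1n ltnS leq_sum.
have card_I : #|I| = d.+1.
  apply/eqP; rewrite eqn_leq cardI_le (leq_trans le_s) // -sum1_card leq_sum //.
have le_wm : (w <= m)%MM.
  apply/mnm_lepP => i; have [iI | nI] := boolP (i \in I).
    by rewrite w1 // lt0n; rewrite inE in iI.
  have : (\sum_(j in I) w j + w i <= d.+1)%N.
    rewrite -deg_w mdegE [X in (_ <= X)%N](bigID (mem I)) /= leq_add2l.
    by rewrite [X in (_ <= X)%N](bigD1 i) //= leq_addr.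
  by rewrite (eq_bigr (fun=> 1%N)) // sum1_card card_I; lia.
have /eqP : mdeg (m - w)%MM = 0%N by have := mdeg_le le_wm; rewrite deg_m deg_w; lia.
by rewrite mdeg_eq0 => /eqP mw; rewrite -(submK le_wm) mw add0m.
Qed.

(** A decomposition of the class gives two invariant forms all of whose products
    of monomials lie in the complex. If both have positive degree, this is
    excluded by hypothesis. If one is constant, the support of the other one is
    the whole complex. *)
Lemma irreducible_circuit d Delta f0 : (d <= 2)%N ->
  (forall m, m \in monomials Delta -> mdeg m = d.+1 /\ forall i, (m i <= 1)%N) ->
  circuit K d.+1 (monomials Delta) ->
  invariant_form d.+1 f0 -> {subset msupp f0 <= monomials Delta} ->
  (forall deg1 deg2 f g, invariant_form deg1 f -> invariant_form deg2 g ->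
     (0 < deg1)%N -> (0 < deg2)%N -> (deg1 + deg2 = d.+1)%N ->
     (forall u v, u \in msupp f -> v \in msupp g ->
        (u + v)%MM \in monomials Delta) -> False) ->
  irreducible_class pt (complex_class d Delta).
Proof.
move=> le_d2 s_sqf circ F0 sub0 indec; rewrite complex_classE.
set s := monomials Delta in s_sqf circ sub0 indec *.
have circE f : invariant_form d.+1 f -> {subset msupp f <= s} -> msupp f =i s.
  by case=> *; apply: circ.
split.
- apply: (effective_form F0) => // I; rewrite ffunE subrK.
  by rewrite lez_nat max_indeg_sub.
- by apply/eqP => /(congr1 fst).
move=> A B /effP[deg1 [f [nz_f homf invf A1 A2]]].
move=> /effP[deg2 [g [nz_g homg invg B1 B2]]] DE.
have degE : (deg1 + deg2 = d.+1)%N.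
  by have := congr1 fst DE; rewrite /= A1 B1 => -[]; lia.
have D2 (I : center) : (max_indeg (val I) s)%:Z - d.+1%:Z = A.2 I + B.2 I.
  by have := congr1 (fun D : Pic => D.2 I) DE; rewrite !ffunE.
have sum_in u v : u \in msupp f -> v \in msupp g -> (u + v)%MM \in s.
  move=> uf vg; apply: (sum_support le_d2 s_sqf _ uf vg) => [I|].
    have := D2 I; have := A2 I; have := B2 I; rewrite -degE -lez_nat.
    move: (max_indeg _ _) (max_indeg _ _) (max_indeg _ _) (A.2 I) (B.2 I).
    by clear; lia.
  by rewrite mdegD (dhomog_mf homf uf) (dhomog_mf homg vg).
(* The summand with the constant form h has only exceptional divisors; they have
   coefficient zero, as k already accounts for all multiplicities. *)
have zero_case (h k : {mpoly K[6]}) e (C E : Pic) : h != 0 -> h \is 0.-homog ->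
    invariant_form d.+1 k -> e = d.+1 ->
    (forall u v, u \in msupp h -> v \in msupp k -> (u + v)%MM \in s) ->
    C.1 = 0 -> (forall I : center, (max_indeg (val I) (msupp h))%:Z <= C.2 I + 0%:Z) ->
    (forall I : center, (max_indeg (val I) (msupp k))%:Z <= E.2 I + e%:Z) ->
    (forall I : center, (max_indeg (val I) s)%:Z - d.+1%:Z = C.2 I + E.2 I) ->
    C = 0.
  move=> nz_h homh Fk -> hk_in C1 C2 E2 CE2.
  have lh := mlead_supp nz_h.
  have /eqP := dhomog_mf homh lh; rewrite mdeg_eq0 => /eqP lead0.
  have supk : msupp k =i s.
    by apply: circE => // v vk; rewrite -[v]add0m -lead0; apply: hk_in.
  rewrite [C]surjective_pairing C1; congr (_, _); apply/ffunP => I; rewrite ffunE.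
  have eq_max : max_indeg (val I) (msupp k) = max_indeg (val I) s.
    by apply/eqP; rewrite eqn_leq !max_indeg_sub // => u; rewrite supk.
  have := C2 I; have := E2 I; have := CE2 I; rewrite eq_max.
  by move: (max_indeg _ _) (max_indeg _ _) (C.2 I) (E.2 I); clear; lia.
case: (posnP deg1) => [deg1_0|deg1_gt0].
  left; move: (degE); rewrite deg1_0 add0n => deg2E; rewrite deg1_0 in homf A1 A2.
  by apply: (zero_case f g deg2 A B) => //; split=> //; rewrite -deg2E.
case: (posnP deg2) => [deg2_0|deg2_gt0].
  right; move: (degE); rewrite deg2_0 addn0 => deg1E; rewrite deg2_0 in homg B1 B2.
  apply: (zero_case g f deg1 B A) => // [|u v ug vf|I].
  - by split=> //; rewrite -deg1E.
  - by rewrite addmC; apply: sum_in.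
  by rewrite D2 addrC.
by have := indec deg1 deg2 f g; case.
Qed.

End Classes.

(** * Supports that contain no product *)

(* Finds, for each vertex of an explicit list, an edge among the hypotheses. *)
Ltac incident :=
  let x := fresh "x" in let H := fresh "mem" in
  move=> x H; list_cases H; rewrite (eqP H);
  match goal with
  | E : is_true (adj _ ?a ?b) |- exists _, is_true (adj _ ?a _) \/ _ =>
      exists b; left; exact E
  | E : is_true (adj _ ?b ?a) |- exists _, is_true (adj _ ?a _) \/ _ =>
      exists b; right; exact E
  end.

Section Indecomposable.
Variable K : fieldType.
Hypothesis charK : [pchar K] =i pred0.
Implicit Types (f g : {mpoly K[6]}) (s : seq 'X_{1..6}).

(** The coefficients of an invariant linear form sum to zero. *)
Lemma linear_two_variables f : invariant_form 1 f ->
  exists a b, [/\ a != b, U_(a)%MM \in msupp f & U_(b)%MM \in msupp f].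
Proof.
move=> [nz_f homf invf]; have lf := mlead_supp nz_f.
have [a aE] := mdeg1E (dhomog_mf homf lf); rewrite aE in lf.
have sum0 := sum_derivatives homf invf mdeg0.
have /existsP[b /andP[nab bf]] : [exists b, (b != a) && (U_(b)%MM \in msupp f)].
  apply: contraT => /existsPn none; move: lf; rewrite mcoeff_msupp => /eqP[].
  rewrite -[RHS]sum0 (bigD1 a) //= big1 => [|b nab].
    by rewrite addr0 mnm0E add0m mulr1n.
  have := none b; rewrite nab /= => /memN_msupp_eq0.
  by rewrite add0m => ->; rewrite mul0rn.
by exists a, b; rewrite eq_sym.
Qed.

Lemma invariant_diff_form i j : i != j -> invariant_form 1 (diff K i j : {mpoly K[6]}).
Proof.
by move=> nij; split; [exact: diff_neq0 | exact: homog_diff | exact: invariant_diff].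
Qed.

Lemma invariant_formM deg1 deg2 f g :
  invariant_form deg1 f -> invariant_form deg2 g ->
  invariant_form (deg1 + deg2) (f * g).
Proof.
move=> [nz_f homf invf] [nz_g homg invg]; split; last exact: invariantM.
  by rewrite mulf_neq0.
exact: dhomogM.
Qed.

Lemma mem_msupp_diff i j u : u \in msupp (diff K i j : {mpoly K[6]}) ->
  u = U_(i)%MM \/ u = U_(j)%MM.
Proof. by move/msupp_diff; rewrite !inE => /orP[] /eqP ->; [left | right]. Qed.

(** A product of two linear forms contains a square, so a graph circuit of this
    form has only four vertices. *)
Lemma graph_indecomposable s (t : seq 'I_6) f g : circuit K 2 s ->
  squarefree_list s -> uniq t -> (4 < size t)%N ->
  (forall x, x \in t -> exists2 m, m \in s & (0 < m x)%N) ->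
  invariant_form 1 f -> invariant_form 1 g ->
  (forall u v, u \in msupp f -> v \in msupp g -> (u + v)%MM \in s) -> False.
Proof.
move=> circ sqf uniq_t size_t inc Ff Fg sum_in.
have [a [b [nab af bf]]] := linear_two_variables Ff.
have [c [d [ncd cg dg]]] := linear_two_variables Fg.
have Fab := invariant_diff_form nab; have Fcd := invariant_diff_form ncd.
have [nz_h homh invh] := invariant_formM Fab Fcd.
have sub_h : {subset msupp (diff K a b * diff K c d) <= s}.
  move=> u /msuppM_diff[v /mem_msupp_diff vE uE].
  by case: uE => ->; case: vE => ->; apply: sum_in.
have supp_h := circ _ nz_h homh invh sub_h.
have sub_t : {subset t <= [:: a; b; c; d]}.
  move=> x /inc[m]; rewrite -supp_h => /msuppM_diff[v /mem_msupp_diff vE mE].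
  by case: mE => ->; case: vE => ->; rewrite !inE mnmDE !mnm1E !(eq_sym x);
    case: (a == x); case: (b == x); case: (c == x); case: (d == x).
by have := uniq_leq_size uniq_t sub_t; rewrite /= leqNgt size_t.
Qed.

Lemma graph_of_form f : invariant_form 2 f -> squarefree f ->
  [\/ has_square (link f 0), has_bowtie (link f 0), has_hexagon (link f 0)
    | has_joined_triangles (link f 0)].
Proof.
move=> [nz_f homf invf] sqf; have lf := mlead_supp nz_f.
have [x [y xyE]] := mdeg2E (dhomog_mf homf lf); rewrite xyE in lf.
apply: (balanced_graph charK card_I6 (link_sym f 0) (link_irr _ sqf)
  (graph_sum0 sqf homf invf)).
by rewrite adj_link0; exact: lf.
Qed.

(** Let a and b be variables of the linear form. The quadratic form involves
    neither, so its graph has at most four vertices and contains a square. The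
    complex thus contains an octahedron with opposite vertices a and b; being a
    circuit it equals the octahedron, where a and b have no common face. *)
Lemma neighbourly_indecomposable i1 i2 i3 i4 i5 i6 f g :
  uniq [:: i1; i2; i3; i4; i5; i6] ->
  invariant_form 1 f -> invariant_form 2 g ->
  (forall u v, u \in msupp f -> v \in msupp g ->
     (u + v)%MM \in neighbourly i1 i2 i3 i4 i5 i6) -> False.
Proof.
set s := neighbourly _ _ _ _ _ _ => uI Ff Fg sum_in.
have sqf_s : squarefree_list s by apply: neighbourly_squarefree.
have [a [b [nab af bf]]] := linear_two_variables Ff.
have sqf_g : squarefree g.
  move=> v vg i; apply: leq_trans (sqf_s _ (sum_in _ _ af vg) i).
  by rewrite mnmDE leq_addl.
have avoid x y : adj (link g 0) x y -> x \notin [:: a; b].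
  rewrite adj_link0 !inE => xyg; apply/norP; split.
    apply: contraTneq (sqf_s _ (sum_in _ _ af xyg) a) => ->.
    by rewrite !mnmDE !mnm1E eqxx; lia.
  apply: contraTneq (sqf_s _ (sum_in _ _ bf xyg) b) => ->.
  by rewrite !mnmDE !mnm1E eqxx; lia.
have few (t : seq 'I_6) : uniq t ->
    (forall x, x \in t -> exists y, adj (link g 0) x y \/ adj (link g 0) y x) ->
    (size t <= 4)%N.
  move=> ut out.
  have out_ab x : x \in t -> x \notin [:: a; b].
    move=> /out[y []]; first exact: avoid.
    by rewrite (adj_sym (link_sym g 0)); apply: avoid.
  have uabt : uniq ([:: a; b] ++ t).
    rewrite cat_uniq ut /= inE nab /= andbT; apply/hasPn => x; exact: out_ab.
  by have := max_card (mem ([:: a; b] ++ t)); rewrite card_ord (card_uniqP uabt).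
have [sq | bow | hexa | joi] := graph_of_form Fg sqf_g.
- have [c1 [c2 [c3 [c4 [uc a12 a23 a34 a41]]]]] := sq.
  have n13 : c1 != c3 by distinct.
  have n24 : c2 != c4 by distinct.
  have Fsq := invariant_formM (invariant_diff_form n13) (invariant_diff_form n24).
  have [nz_h homh invh] := invariant_formM (invariant_diff_form nab) Fsq.
  have mem_sq v : v \in msupp (diff K c1 c3 * diff K c2 c4) ->
      v \in msupp g.
    rewrite !adj_link0 in a12 a23 a34 a41.
    move=> /msuppM_diff[w /mem_msupp_diff wE vE].
    case: vE => ->; case: wE => -> //; last by rewrite addmC.
    by rewrite addmC.
  have sub_h : {subset msupp (diff K a b * (diff K c1 c3 * diff K c2 c4)) <= s}.
    move=> u /msuppM_diff[v /mem_sq vg [] ->]; exact: sum_in.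
  have supp_h := circuit_neighbourly charK uI nz_h homh invh sub_h.
  have [m ms lt_m] := neighbourly_pair uI nab.
  move: ms; rewrite -supp_h => /msuppM_diff[v /mem_sq vg mE].
  have va : v a = 0%N.
    have := sqf_s _ (sum_in _ _ af vg) a; rewrite mnmDE mnm1E eqxx.
    by case: (v a).
  have vb : v b = 0%N.
    have := sqf_s _ (sum_in _ _ bf vg) b; rewrite mnmDE mnm1E eqxx.
    by case: (v b).
  case: mE lt_m => ->; rewrite !mnmDE !mnm1E va vb eqxx.
    by rewrite (negPf nab).
  by rewrite eq_sym (negPf nab).
- have [i [j [k [p [q [ut [[e1 e2 e3] [e4 e5 e6]]]]]]]] := bow.
  suff: (size [:: i; j; k; p; q] <= 4)%N by [].
  by apply: few; [exact: ut | incident].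
- have [i [j [k [p [q [r [ut [[e1 e2 e3] [e4 e5 e6]]]]]]]]] := hexa.
  suff: (size [:: i; j; k; p; q; r] <= 4)%N by [].
  by apply: few; [exact: ut | incident].
have [i [j [k [r [p [q [ut [e1 e2 e3] [e4 e5 e6] e7]]]]]]] := joi.
suff: (size [:: i; j; k; r; p; q] <= 4)%N by [].
by apply: few; [exact: ut | incident].
Qed.

End Indecomposable.

(** * The complexes of the classification *)

(** Stated over an abstract type, so that the conversion unfolds no multiset. *)
Lemma fset_list2 (T : choiceType) (a b : T) : [fset a; b] =i [:: a; b].
Proof. by move=> x; rewrite !inE. Qed.

Lemma fset_list6 (T : choiceType) (a b c d e f : T) :
  [fset a; b; c; d; e; f] =i [:: a; b; c; d; e; f].
Proof. by move=> x; rewrite !inE -!orbA. Qed.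

Lemma fset_list7 (T : choiceType) (a b c d e f g : T) :
  [fset a; b; c; d; e; f; g] =i [:: a; b; c; d; e; f; g].
Proof. by move=> x; rewrite !inE -!orbA. Qed.

Lemma fset_list12 (T : choiceType) (a b c d e f g h i j k l : T) :
  [fset a; b; c; d; e; f; g; h; i; j; k; l] =i
  [:: a; b; c; d; e; f; g; h; i; j; k; l].
Proof. by move=> x; rewrite !inE -!orbA. Qed.

Section Families.
Variable K : fieldType.
Hypothesis charK : [pchar K] =i pred0.
Implicit Types i j k p q r : 'I_6.

Lemma mnm_of1 i : mnm_of [mset i] = U_(i)%MM.
Proof. by apply/mnmP => x; rewrite mnmE mnm1E msetnE eq_sym; case: eqP. Qed.

Lemma mnm_of2 i j : mnm_of [mset i; j] = mon2 i j.
Proof.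
apply/mnmP => x; rewrite mnmE mset1DE mnmDE !mnm1E msetnE !(eq_sym x).
by case: (j == x).
Qed.

Lemma mnm_of3 i j k : mnm_of [mset i; j; k] = mon3 i j k.
Proof.
apply/mnmP => x; rewrite mnmE msetE2 mset1DE !mnmDE !mnm1E !msetnE !(eq_sym x).
by case: (j == x); case: (k == x).
Qed.

Lemma monomials_list (Delta : {fset {mset 'I_6}}) (l : seq {mset 'I_6}) :
  Delta =i l -> monomials Delta =i [seq mnm_of s | s <- l].
Proof.
move=> eq_l u; apply/mapP/mapP => [] [s sD ->]; exists s => //.
  by rewrite -eq_l.
by rewrite eq_l.
Qed.

Lemma monomials_B i j : monomials (complexB i j) =i [:: U_(i)%MM; U_(j)%MM].
Proof. by rewrite -!mnm_of1; apply: monomials_list (fset_list2 _ _). Qed.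

Lemma monomials_H i j k p q r :
  monomials (complexH i j k p q r) =i hexagon i j k p q r.
Proof.
rewrite /hexagon /edge_monomials /= -!mnm_of2.
exact: monomials_list (fset_list6 _ _ _ _ _ _).
Qed.

Lemma monomials_T i j k p q : monomials (complexT i j k p q) =i bowtie i j k p q.
Proof.
rewrite /bowtie /edge_monomials /= -!mnm_of2.
exact: monomials_list (fset_list6 _ _ _ _ _ _).
Qed.

Lemma monomials_P i j k r p q :
  monomials (complexP i j k r p q) =i joined_triangles i j k r p q.
Proof.
rewrite /joined_triangles /edge_monomials /= -!mnm_of2.
exact: monomials_list (fset_list7 _ _ _ _ _ _ _).
Qed.

Lemma monomials_C (i1 i2 i3 i4 i5 i6 : 'I_6) :
  monomials (complexC i1 i2 i3 i4 i5 i6) =i neighbourly i1 i2 i3 i4 i5 i6.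
Proof.
rewrite /neighbourly /face_monomials /= -!mnm_of3.
exact: monomials_list (fset_list12 _ _ _ _ _ _ _ _ _ _ _ _).
Qed.

End Families.

(** * The classification *)

Section Classification.
Variable K : fieldType.
Hypothesis charK : [pchar K] =i pred0.
Variable pt : 'M[K]_(6, 5).
Hypothesis gen_pt : general_position pt.

Definition vertices (es : seq ('I_6 * 'I_6)) : seq 'I_6 :=
  flatten [seq [:: e.1; e.2] | e <- es].

Lemma mem_vertices es x : x \in vertices es ->
  exists2 m, m \in edge_monomials es & (0 < m x)%N.
Proof.
case/flatten_mapP => e e_in; rewrite !inE => xe.
exists (mon2 e.1 e.2); first exact: map_f.
by rewrite mnmDE !mnm1E !(eq_sym _ x); case/orP: xe => ->; lia.
Qed.

Lemma mdeg_edge (es : seq ('I_6 * 'I_6)) m : m \in edge_monomials es -> mdeg m = 2%N.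
Proof. by case/mapP => e _ ->; rewrite mdeg_mon2. Qed.

Lemma mdeg_face (ts : seq ('I_6 * 'I_6 * 'I_6)) m :
  m \in face_monomials ts -> mdeg m = 3%N.
Proof. by case/mapP => t _ ->; rewrite mdeg_mon3. Qed.

Lemma complex_monomials d (Delta : {fset {mset 'I_6}}) :
  is_complex d Delta -> nonsingular Delta ->
  (forall m, m \in monomials Delta -> mdeg m = d.+1) /\
  squarefree_list (monomials Delta).
Proof.
move=> complexD nonsing; split=> [_ /mapP[s sD ->]|_ /mapP[s sD ->] i].
  by rewrite mdeg_mnm_of complexD.
rewrite mnmE; have := nonsing s sD i; rewrite in_mset.
by case: (s i) => // k /(_ isT) ->.
Qed.

Lemma complex_of_monomials d (Delta : {fset {mset 'I_6}}) :
  (forall m, m \in monomials Delta -> mdeg m = d.+1) ->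
  squarefree_list (monomials Delta) ->
  is_complex d Delta /\ nonsingular Delta.
Proof.
move=> degD sqfD; split=> [s sD | s sD i].
  by rewrite -mdeg_mnm_of degD // map_f.
rewrite in_mset => si; apply/eqP; rewrite eqn_leq si andbT.
by have := sqfD _ (map_f _ sD) i; rewrite mnmE.
Qed.

Definition balanced_irreducible (D : Pic) :=
  irreducible_class pt D /\
  exists (d : nat) (Delta : {fset {mset 'I_6}}),
    Delta != fset0 /\ is_complex d Delta /\ nonsingular Delta /\
    balanceable K d Delta /\ D = complex_class d Delta.

Lemma circuit_class d Delta (s : seq 'X_{1..6}) (f0 : {mpoly K[6]}) :
  (d <= 2)%N -> monomials Delta =i s ->
  (forall m, m \in s -> mdeg m = d.+1) -> squarefree_list s ->
  circuit K d.+1 s -> invariant_form d.+1 f0 -> {subset msupp f0 <= s} ->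
  (forall deg1 deg2 (f g : {mpoly K[6]}),
     invariant_form deg1 f -> invariant_form deg2 g ->
     (0 < deg1)%N -> (0 < deg2)%N -> (deg1 + deg2 = d.+1)%N ->
     (forall u v, u \in msupp f -> v \in msupp g -> (u + v)%MM \in s) -> False) ->
  balanced_irreducible (complex_class d Delta).
Proof.
move=> le_d2 eq_s deg_s sqf_s circ F0 sub0 indec.
have degD m : m \in monomials Delta -> mdeg m = d.+1 by rewrite eq_s; apply: deg_s.
have sqfD : squarefree_list (monomials Delta) by move=> m; rewrite eq_s; apply: sqf_s.
have [complexD nonsing] := complex_of_monomials degD sqfD.
have [nz0 hom0 inv0] := F0; have supp0 := circ f0 nz0 hom0 inv0 sub0.
split.
  apply: (irreducible_circuit charK gen_pt le_d2 _ _ F0) => //.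
  - by move=> m mD; split; [apply: degD | apply: sqfD].
  - move=> f nz_f homf invf sub m; rewrite eq_s; apply: circ => // u /sub.
    by rewrite eq_s.
  - by move=> u /sub0; rewrite eq_s.
  move=> deg1 deg2 f g Ff Fg gt1 gt2 degE sum_in.
  by apply: (indec _ _ _ _ Ff Fg) => // u v uf vg; rewrite -eq_s sum_in.
exists d, Delta; split; last split=> //; last split=> //; last split=> //.
  apply/eqP => D0; have := mlead_supp nz0; rewrite supp0 -eq_s D0.
  by case/mapP.
apply/(balanceableP K complexD); exists f0; split=> // m.
by rewrite supp0 eq_s.
Qed.

Lemma circuit_pair i j : circuit K 1 [:: U_(i)%MM; U_(j)%MM : 'X_{1..6}].
Proof.
move=> f nz_f homf invf sub; have Ff : invariant_form 1 f by split.
have [a [b [nab af bf]]] := linear_two_variables Ff.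
move=> m; apply/idP/idP => [/sub // |]; have := sub _ af; have := sub _ bf.
rewrite !inE !mnm1_eq => /orP[] /eqP bE /orP[] /eqP aE; rewrite aE bE in nab af bf *.
- by rewrite eqxx in nab.
- by case/orP => /eqP ->.
- by case/orP => /eqP ->.
by rewrite eqxx in nab.
Qed.

Lemma balanced_irreducible_B i j : uniq [:: i; j] ->
  balanced_irreducible (complex_class 0 (complexB i j)).
Proof.
rewrite /= inE andbT => nij.
apply: (circuit_class _ (monomials_B i j) _ _ _ (invariant_diff_form K nij)) => //.
- by move=> m; rewrite !inE => /orP[] /eqP ->; rewrite mdeg1.
- by move=> m; rewrite !inE => /orP[] /eqP -> x; rewrite mnm1E; case: eqP.
- exact: circuit_pair.
- exact: msupp_diff.
by move=> deg1 deg2 f g _ _ gt1 gt2; lia.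
Qed.

Lemma graph_class Delta es (t : seq 'I_6) (f0 : {mpoly K[6]}) :
  monomials Delta =i edge_monomials es -> squarefree_list (edge_monomials es) ->
  circuit K 2 (edge_monomials es) -> f0 != 0 ->
  translation_invariant f0 /\ f0 \is 2.-homog ->
  {subset msupp f0 <= edge_monomials es} ->
  uniq t -> (4 < size t)%N -> all (mem (vertices es)) t ->
  balanced_irreducible (complex_class 1 Delta).
Proof.
move=> eq_s sqf_s circ nz0 [inv0 hom0] sub0 uniq_t size_t /allP vert_t.
have F0 : invariant_form 2 f0 by split.
apply: (circuit_class _ eq_s _ sqf_s circ F0 sub0) => //.
  by move=> m; apply: mdeg_edge.
move=> deg1 deg2 f g Ff Fg gt1 gt2 degE.
have deg1E : deg1 = 1%N by lia.
have deg2E : deg2 = 1%N by lia.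
rewrite deg1E in Ff; rewrite deg2E in Fg.
apply: (graph_indecomposable circ sqf_s uniq_t size_t _ Ff Fg) => x /vert_t.
exact: mem_vertices.
Qed.

Lemma balanced_irreducible_H i j k p q r : uniq [:: i; j; k; p; q; r] ->
  balanced_irreducible (complex_class 1 (complexH i j k p q r)).
Proof.
move=> u; apply: (graph_class (t := [:: i; j; k; p; q; r]) (monomials_H i j k p q r)
  (hexagon_squarefree u) (circuit_hexagon u) (form_hexagon_neq0 K u)
  (form_hexagonP K i j k p q r) (@msupp_hexagon K _ i j k p q r) u) => //.
by rewrite /= !inE !eqxx ?orbT.
Qed.

Lemma balanced_irreducible_T i j k p q : uniq [:: i; j; k; p; q] ->
  balanced_irreducible (complex_class 1 (complexT i j k p q)).
Proof.
move=> u; apply: (graph_class (t := [:: i; j; k; p; q]) (monomials_T i j k p q)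
  (bowtie_squarefree u) (circuit_bowtie charK u) (form_bowtie_neq0 K u)
  (form_bowtieP K i j k p q) (@msupp_bowtie K _ i j k p q) u) => //.
by rewrite /= !inE !eqxx ?orbT.
Qed.

Lemma balanced_irreducible_P i j k r p q : uniq [:: i; j; k; r; p; q] ->
  balanced_irreducible (complex_class 1 (complexP i j k r p q)).
Proof.
move=> u; apply: (graph_class (t := [:: i; j; k; r; p; q])
  (monomials_P i j k r p q) (joined_triangles_squarefree u)
  (circuit_joined charK u) (form_joined_neq0 K u)
  (form_joinedP K i j k r p q) (@msupp_joined K _ i j k r p q) u) => //.
by rewrite /= !inE !eqxx ?orbT.
Qed.

Lemma balanced_irreducible_C i1 i2 i3 i4 i5 i6 : uniq [:: i1; i2; i3; i4; i5; i6] ->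
  balanced_irreducible (complex_class 2 (complexC i1 i2 i3 i4 i5 i6)).
Proof.
move=> u; have [inv0 hom0] := form_neighbourlyP K i1 i2 i3 i4 i5 i6.
have F0 : invariant_form 3 (form_neighbourly K i1 i2 i3 i4 i5 i6).
  by split; first exact: form_neighbourly_neq0.
apply: (circuit_class _ (monomials_C i1 i2 i3 i4 i5 i6) _ (neighbourly_squarefree u)
  (circuit_neighbourly charK u) F0 (@msupp_neighbourly K _ i1 i2 i3 i4 i5 i6)) => //.
  by move=> m; apply: mdeg_face.
move=> deg1 deg2 f g Ff Fg gt1 gt2 degE sum_in.
have [[deg1E deg2E] | [deg1E deg2E]] :
    (deg1 = 1 /\ deg2 = 2)%N \/ (deg1 = 2 /\ deg2 = 1)%N by lia.
  rewrite deg1E in Ff; rewrite deg2E in Fg.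
  exact: (neighbourly_indecomposable charK u Ff Fg sum_in).
rewrite deg1E in Ff; rewrite deg2E in Fg.
apply: (neighbourly_indecomposable charK u Fg Ff) => v w vg wf.
by rewrite addmC; apply: sum_in.
Qed.

Lemma class_identified d Delta Gamma (s : seq 'X_{1..6}) (f : {mpoly K[6]}) :
  irreducible_class pt (complex_class d Delta) -> invariant_form d.+1 f ->
  {subset msupp f <= s} -> circuit K d.+1 s -> monomials Gamma =i s ->
  {subset s <= monomials Delta} ->
  complex_class d Delta = complex_class d Gamma.
Proof.
move=> irrD Ff sub_s circ eq_s sub_D; have [nz_f homf invf] := Ff.
rewrite (class_of_subform charK gen_pt irrD Ff) => [|u /sub_s/sub_D //].
rewrite complex_classE; apply: eq_class_of => u.
by rewrite eq_s circ.
Qed.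

(** Complementary coefficients agree up to sign, but the complement of more than
    three of six variables has smaller degree, where the coefficients vanish. *)
Lemma squarefree_degree deg (f : {mpoly K[6]}) : invariant_form deg f ->
  squarefree f -> (deg <= 3)%N.
Proof.
move=> [nz_f homf invf] sqf; rewrite leqNgt; apply/negP => gt3.
have lf := mlead_supp nz_f; have lE := squarefree_mesym1 (sqf _ lf).
set A := [set i | _] in lE.
have cardA : #|A| = deg by rewrite -mdeg_mesym1 -lE; exact: (dhomog_mf homf lf).
have cardC : (#|~: A| < deg)%N by have := cardsC A; rewrite cardA card_ord; lia.
have := coef_setC (A := A) sqf homf invf.
rewrite cardA leqnn (ltnW cardC) => /(_ isT isT).
rewrite -lE (dhomog_nemf_coeff homf (m := mesym1 (~: A))) ?mulr0.
  by move/eqP; rewrite mcoeff_eq0 lf.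
by rewrite /= mdeg_mesym1 ltn_eqF.
Qed.

Lemma exists_outside (t : seq 'I_6) : (size t < 6)%N -> exists r, r \notin t.
Proof.
move=> lt_t; apply/existsP; rewrite -negb_forall; apply/negP => /forallP all_t.
have := uniq_leq_size (enum_uniq 'I_6) (s2 := t) (fun x _ => all_t x).
by rewrite size_enum_ord leqNgt lt_t.
Qed.

End Classification.

Section Forward.
Variable K : fieldType.
Hypothesis charK : [pchar K] =i pred0.
Variable pt : 'M[K]_(6, 5).
Hypothesis gen_pt : general_position pt.
Variable Delta : {fset {mset 'I_6}}.
Variable f : {mpoly K[6]}.
Hypothesis supp_f : msupp f =i monomials Delta.
Hypothesis sqf : squarefree f.

Lemma subset_supp (s : seq 'X_{1..6}) : all (mem (msupp f)) s ->
  {subset s <= monomials Delta}.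
Proof. by move=> /allP s_f m /s_f; rewrite -supp_f. Qed.

Lemma forward_points : invariant_form 1 f ->
  irreducible_class pt (complex_class 0 Delta) ->
  exists i j : 'I_6, uniq [:: i; j] /\
    complex_class 0 Delta = complex_class 0 (complexB i j).
Proof.
move=> Ff irrD; have [a [b [nab af bf]]] := linear_two_variables Ff.
exists a, b; split; first by rewrite /= inE nab.
apply: (class_identified charK gen_pt irrD (invariant_diff_form K nab)
  (@msupp_diff K _ a b) (@circuit_pair K a b) (monomials_B a b)).
by apply: subset_supp; rewrite /= af bf.
Qed.

(** A square in the graph is the support of a product of two differences, which
    irreducibility excludes; the other configurations are circuits. *)
Lemma forward_graph : invariant_form 2 f ->
  irreducible_class pt (complex_class 1 Delta) ->
  (exists i j k p q r : 'I_6, uniq [:: i; j; k; p; q; r] /\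
      complex_class 1 Delta = complex_class 1 (complexH i j k p q r)) \/
  (exists i j k p q : 'I_6, uniq [:: i; j; k; p; q] /\
      complex_class 1 Delta = complex_class 1 (complexT i j k p q)) \/
  (exists i j k r p q : 'I_6, uniq [:: i; j; k; r; p; q] /\
      complex_class 1 Delta = complex_class 1 (complexP i j k r p q)).
Proof.
move=> Ff irrD; case: (graph_of_form charK Ff sqf).
- move=> [a [b [c [d [u]]]]]; rewrite !adj_link0 => ab bc cd da.
  have nac : a != c by distinct.
  have nbd : b != d by distinct.
  case: (no_product charK gen_pt irrD (invariant_diff_form K nac)
    (invariant_diff_form K nbd)) => // v w /mem_msupp_diff vE /mem_msupp_diff wE.
  rewrite -supp_f; case: vE => ->; case: wE => -> //; last by rewrite addmC.
  by rewrite addmC.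
- move=> [i [j [k [p [q [u]]]]]]; rewrite !adj_link0 => -[[e1 e2 e3] [e4 e5 e6]].
  right; left; exists i, j, k, p, q; split=> //.
  have [inv0 hom0] := form_bowtieP K i j k p q.
  have F0 : invariant_form 2 (form_bowtie K i j k p q).
    by split; first exact: form_bowtie_neq0.
  apply: (class_identified charK gen_pt irrD F0 (@msupp_bowtie K _ i j k p q)
    (circuit_bowtie charK u) (monomials_T i j k p q)).
  by apply: subset_supp; rewrite /= e1 e2 e3 e4 e5 e6.
- move=> [i [j [k [p [q [r [u]]]]]]]; rewrite !adj_link0 => -[[e1 e2 e3] [e4 e5 e6]].
  left; exists i, j, k, p, q, r; split=> //.
  have [inv0 hom0] := form_hexagonP K i j k p q r.
  have F0 : invariant_form 2 (form_hexagon K i j k p q r).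
    by split; first exact: form_hexagon_neq0.
  apply: (class_identified charK gen_pt irrD F0 (@msupp_hexagon K _ i j k p q r)
    (circuit_hexagon u) (monomials_H i j k p q r)).
  by apply: subset_supp; rewrite /= e1 e2 e3 e4 e5 e6.
move=> [i [j [k [r [p [q [u]]]]]]]; rewrite !adj_link0 => -[e1 e2 e3] [e4 e5 e6] e7.
right; right; exists i, j, k, r, p, q; split=> //.
have [inv0 hom0] := form_joinedP K i j k r p q.
have F0 : invariant_form 2 (form_joined K i j k r p q).
  by split; first exact: form_joined_neq0.
apply: (class_identified charK gen_pt irrD F0 (@msupp_joined K _ i j k r p q)
  (circuit_joined charK u) (monomials_P i j k r p q)).
by apply: subset_supp; rewrite /= e1 e2 e3 e4 e5 e6 e7.
Qed.

(** The link of a vertex l is a graph on the five other vertices, and the faces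
    avoiding l are the complements of those containing it. A square in the link
    gives an octahedron, the support of a product of three differences. A bowtie
    in the link determines the complex with twelve faces. *)
Lemma forward_triples : invariant_form 3 f ->
  irreducible_class pt (complex_class 2 Delta) ->
  exists i1 i2 i3 i4 i5 i6 : 'I_6, uniq [:: i1; i2; i3; i4; i5; i6] /\
    complex_class 2 Delta = complex_class 2 (complexC i1 i2 i3 i4 i5 i6).
Proof.
move=> Ff irrD; have [nz_f homf invf] := Ff; have lf := mlead_supp nz_f.
have [l [y [z lyzE]]] := mdeg3E (dhomog_mf homf lf); rewrite lyzE -addmA in lf.
have compl := complement_msupp sqf homf invf.
have sum0 x : \sum_w link f U_(l) x w = 0 by apply: link_sum; rewrite ?mdeg1.
have adjE x w : adj (link f U_(l)) x w = (mon3 x w l \in msupp f).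
  by rewrite adj_link addmC.
have avoid x w : adj (link f U_(l)) x w -> x != l.
  rewrite adj_link => /sqf/(_ l); apply: contraTneq => ->.
  by rewrite !mnmDE !mnm1E eqxx; lia.
have outside (t : seq 'I_6) :
    (forall x, x \in t ->
       exists w, adj (link f U_(l)) x w \/ adj (link f U_(l)) w x) ->
    l \notin t.
  move=> inc; apply/negP => /inc[w []].
    by move/avoid; rewrite eqxx.
  by rewrite (adj_sym (link_sym f _)) => /avoid; rewrite eqxx.
have few (t : seq 'I_6) : uniq t -> l \notin t -> (size t <= 5)%N.
  move=> ut lt; have := max_card (mem (l :: t)); rewrite card_ord.
  by rewrite (card_uniqP _) //= lt.
have lyz : adj (link f U_(l)) y z by rewrite adj_link; exact: lf.
case: (balanced_graph charK card_I6 (link_sym f U_(l)) (link_irr _ sqf) sum0 lyz).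
- move=> [a [b [c [d [u ab bc cd da]]]]].
  have l_out : l \notin [:: a; b; c; d] by apply: outside; incident.
  have [|r r_out] := exists_outside (t := [:: l; a; b; c; d]) _; first by [].
  have uall : uniq [:: r; l; a; b; c; d] by rewrite cons_uniq r_out cons_uniq l_out u.
  have nlr : l != r by distinct.
  have nac : a != c by distinct.
  have nbd : b != d by distinct.
  rewrite !adjE in ab bc cd da.
  have perm x v w : mon3 v w x = (U_(x) + mon2 v w)%MM by rewrite addmC.
  have rab : (mon3 a b r \in msupp f) by rewrite (compl _ _ _ c d l) //; distinct.
  have rbc : (mon3 b c r \in msupp f) by rewrite (compl _ _ _ d a l) //; distinct.
  have rcd : (mon3 c d r \in msupp f) by rewrite (compl _ _ _ a b l) //; distinct.
  have rda : (mon3 d a r \in msupp f) by rewrite (compl _ _ _ b c l) //; distinct.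
  rewrite !perm in ab bc cd da rab rbc rcd rda.
  have Fsq := invariant_formM (invariant_diff_form K nac) (invariant_diff_form K nbd).
  case: (no_product charK gen_pt irrD (invariant_diff_form K nlr) Fsq) => // v w.
  move=> /mem_msupp_diff vE /msuppM_diff[x /mem_msupp_diff xE wE].
  rewrite -supp_f; case: vE => ->; case: wE => ->; case: xE => -> //;
    by rewrite [(U_(_) + U_(_))%MM]addmC.
- move=> [i [j [k [p [q [u [[ij ik jk] [ip iq pq]]]]]]]].
  have l_out : l \notin [:: i; j; k; p; q] by apply: outside; incident.
  have uall : uniq [:: l; i; j; k; p; q] by rewrite cons_uniq l_out u.
  have uC : uniq [:: j; p; q; k; i; l] by distinct.
  exists j, p, q, k, i, l; split=> //.
  have [inv0 hom0] := form_neighbourlyP K j p q k i l.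
  have F0 : invariant_form 3 (form_neighbourly K j p q k i l).
    by split; first exact: form_neighbourly_neq0.
  apply: (class_identified charK gen_pt irrD F0 (@msupp_neighbourly K _ j p q k i l)
    (circuit_neighbourly charK uC) (monomials_C j p q k i l)).
  apply: subset_supp.
  rewrite (adj_sym (link_sym f _) i) in ij; rewrite (adj_sym (link_sym f _) i) in ik.
  rewrite (adj_sym (link_sym f _) i) in ip; rewrite (adj_sym (link_sym f _) i) in iq.
  rewrite !adjE in ij ik jk ip iq pq.
  have c1 : mon3 j p q \in msupp f by rewrite (compl _ _ _ k i l) //; distinct.
  have c2 : mon3 j p k \in msupp f by rewrite (compl _ _ _ q i l) //; distinct.
  have c3 : mon3 j q k \in msupp f by rewrite (compl _ _ _ p i l) //; distinct.
  have c4 : mon3 j k i \in msupp f by rewrite (compl _ _ _ p q l) //; distinct.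
  have c5 : mon3 p q k \in msupp f by rewrite (compl _ _ _ j i l) //; distinct.
  have c6 : mon3 p q i \in msupp f by rewrite (compl _ _ _ j k l) //; distinct.
  by rewrite /= c1 c2 c3 c4 jk ij c5 c6 pq ip iq ik.
- move=> [i [j [k [p [q [r [u [[e1 e2 e3] [e4 e5 e6]]]]]]]]].
  suff /(few _ u) : l \notin [:: i; j; k; p; q; r] by [].
  by apply: outside; incident.
move=> [i [j [k [r [p [q [u [e1 e2 e3] [e4 e5 e6] e7]]]]]]].
suff /(few _ u) : l \notin [:: i; j; k; r; p; q] by [].
by apply: outside; incident.
Qed.

End Forward.

Theorem mainTheorem3 (K : fieldType) (charK : [pchar K] =i pred0)
    (pt : 'M[K]_(6, 5)) (gen_pt : general_position pt) (D : Pic) :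
  (irreducible_class pt D /\
   exists (d : nat) (Delta : {fset {mset 'I_6}}),
     Delta != fset0 /\ is_complex d Delta /\ nonsingular Delta /\
     balanceable K d Delta /\ D = complex_class d Delta)
  <->
  ((exists i j : 'I_6,
      uniq [:: i; j] /\ D = complex_class 0 (complexB i j)) \/
   (exists i j k p q r : 'I_6,
      uniq [:: i; j; k; p; q; r] /\
      D = complex_class 1 (complexH i j k p q r)) \/
   (exists i j k p q : 'I_6,
      uniq [:: i; j; k; p; q] /\
      D = complex_class 1 (complexT i j k p q)) \/
   (exists i j k r p q : 'I_6,
      uniq [:: i; j; k; r; p; q] /\
      D = complex_class 1 (complexP i j k r p q)) \/
   (exists i1 i2 i3 i4 i5 i6 : 'I_6,
      uniq [:: i1; i2; i3; i4; i5; i6] /\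
      D = complex_class 2 (complexC i1 i2 i3 i4 i5 i6))).
Proof.
split; last first.
  case=> [[i [j [u ->]]]|]; first exact: balanced_irreducible_B.
  case=> [[i [j [k [p [q [r [u ->]]]]]]]|]; first exact: balanced_irreducible_H.
  case=> [[i [j [k [p [q [u ->]]]]]]|]; first exact: balanced_irreducible_T.
  case=> [[i [j [k [r [p [q [u ->]]]]]]]|]; first exact: balanced_irreducible_P.
  move=> [i1 [i2 [i3 [i4 [i5 [i6 [u ->]]]]]]]; exact: balanced_irreducible_C.
move=> [irrD [d [Delta [nzD [complexD [nonsing [balD DE]]]]]]]; rewrite DE in irrD *.
have [f [homf invf supp_f]] := (balanceableP K complexD).1 balD.
have [degD sqfD] := complex_monomials complexD nonsing.
have sqf : squarefree f by move=> m; rewrite supp_f; apply: sqfD.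
have nz_f : f != 0.
  have /fset0Pn[s sD] := nzD; apply/eqP => f0.
  by have := supp_f (mnm_of s); rewrite f0 msupp0 map_f.
have Ff : invariant_form d.+1 f by split.
have := squarefree_degree Ff sqf.
case: d {degD sqfD complexD balD homf} Ff irrD DE => [|[|[|d]]] // Ff irrD _ _.
- by left; exact: (forward_points charK gen_pt supp_f Ff irrD).
- right; case: (forward_graph charK gen_pt supp_f sqf Ff irrD) => [H|[H|H]].
  + by left.
  + by right; left.
  by right; right; left.
by do 4 right; exact: (forward_triples charK gen_pt supp_f sqf Ff irrD).
Qed.
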